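(* For every fixed $\omega\in\Omega_0^*\cap\Omega_1^*$ and all real numbers $M,a,b$ with $M>0$ and $1/\alpha<a<b<1$, one has (with the convention $0/0=0$) $$\sup_{(u_1,u_2,v_1,v_2)\in[-M;M]^2\times[a;b]^2}\left\{\frac{|X(u_1,v_1,\omega)-X(u_2,v_2,\omega)|}{|u_1-u_2|^{v_1\vee v_2-1/\alpha}+|v_1-v_2|}\right\}<\infty,$$ where $v_1\vee v_2=\max(v_1,v_2)$.
   Context: Fix $\alpha\in(1,2)$. Let $Z_\alpha(ds)$ be an independently scattered symmetric $\alpha$-stable random measure on $\mathbb{R}$ with Lebesgue control measure on $(\Omega,\mathcal{F},\mathbb{P})$. For $x,\kappa\in\mathbb{R}$, $(x)_+^\kappa=x^\kappa$ if $x>0$ and $0$ otherwise. Let $\psi$ be a three times continuously differentiable compactly supported Daubechies mother wavelet generating an orthonormal basis of $L^2(\mathbb{R})$. For $(x,v)\in\mathbb{R}\times(1/\alpha;1)$, $\Psi(x,v)=\int_{\mathbb{R}}(x-s)_+^{v-1/\alpha}\psi(s)\,ds$; for $(j,k)\in\mathbb{Z}^2$, $\epsilon_{j,k}=2^{j/\alpha}\int_{\mathbb{R}}\psi(2^js-k)Z_\alpha(ds)$. $\Omega_0^*$ is an event of probability $1$ such that for every $\eta>0$ there is a positive finite random variable $C_\eta$ with $|\epsilon_{j,k}(\omega)|\le C_\eta(\omega)(3+|j|)^{1/\alpha+\eta}(3+|k|)^{1/\alpha+\eta}$ for all $\omega\in\Omega_0^*$, $(j,k)\in\mathbb{Z}^2$.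 $\Omega_1^*$ is an event of probability $1$ such that for every $l>0$ there is a positive finite random variable $C'_l$ with $|\epsilon_{j,k}(\omega)|\le C'_l(\omega)2^{j/\alpha}$ for all $\omega\in\Omega_1^*$ and all $(j,k)\in\mathbb{Z}_+\times\mathbb{Z}$ with $|k|2^{-j}\le l$ (both events exist). $X(u,v)=\int_{\mathbb{R}}\{(u-s)_+^{v-1/\alpha}-(-s)_+^{v-1/\alpha}\}Z_\alpha(ds)$ is identified with its modification defined on $\Omega_0^*$ by $X(u,v)=\sum_{(j,k)\in\mathbb{Z}^2}2^{-jv}\epsilon_{j,k}(\Psi(2^ju-k,v)-\Psi(-k,v))$, the series converging on $\Omega_0^*$ uniformly in $(u,v)$ on compact subsets of $\mathbb{R}\times(1/\alpha;1)$. *)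

(* Defs.v *)
From Stdlib Require Import Reals Lra ZArith.
Open Scope R_scope.

Definition pospow (x kappa : R) : R :=
  if Rlt_dec 0 x then Rpower x kappa else 0.

Definition pow2 (t : R) : R := Rpower 2 t.

Definition compact_support (f : R -> R) : Prop :=
  exists A, 0 < A /\ forall s, A < Rabs s -> f s = 0.

Definition is_int_R (f : R -> R) (I : R) : Prop :=
  exists A, 0 < A /\ (forall s, A < Rabs s -> f s = 0) /\
    exists pr : Riemann_integrable f (-A) A, RiemannInt pr = I.

Definition sumZ2 (N : nat) (F : Z -> Z -> R) : R :=
  sum_f_R0 (fun a =>
    sum_f_R0 (fun b => F (Z.of_nat a - Z.of_nat N)%Z (Z.of_nat b - Z.of_nat N)%Z)
      (2 * N)) (2 * N).

Definition C3 (f : R -> R) : Prop :=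
  exists f1 f2 f3 : R -> R,
    (forall x, derivable_pt_lim f x (f1 x)) /\
    (forall x, derivable_pt_lim f1 x (f2 x)) /\
    (forall x, derivable_pt_lim f2 x (f3 x)) /\
    continuity f3.

Definition wav (psi : R -> R) (j k : Z) (s : R) : R :=
  pow2 (IZR j / 2) * psi (pow2 (IZR j) * s - IZR k).

(* {psi_{j,k}} is an orthonormal basis of L^2(R): orthonormality, and
   completeness expressed by Parseval's identity on the dense subspace of
   continuous compactly supported functions. *)
Definition wavelet_ONB (psi : R -> R) : Prop :=
  (forall j k j' k' : Z,
     is_int_R (fun s => wav psi j k s * wav psi j' k' s)
       (if (Z.eqb j j' && Z.eqb k k')%bool then 1 else 0)) /\
  (forall (f : R -> R) (c : Z -> Z -> R) (I : R),
     continuity f -> compact_support f ->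
     (forall j k, is_int_R (fun s => f s * wav psi j k s) (c j k)) ->
     is_int_R (fun s => f s * f s) I ->
     Un_cv (fun N => sumZ2 N (fun j k => c j k * c j k)) I).

(* ratio with the convention 0/0 = 0 (denominator is >= 0 and vanishes only
   when numerator does) *)
Definition ratio0 (num den : R) : R := if Req_EM_T den 0 then 0 else num / den.

(* Main.v *)
From Stdlib Require Import Reals ZArith Lra Lia.
From Coquelicot Require Import Coquelicot.
Require Import Defs.
Open Scope R_scope.

(** Orthonormality against fine-scale wavelets centred near a point where [psi] (then its
    derivative) does not vanish forces [psi] to have two vanishing moments, so its fractional
    primitive [Psi(., v)], together with its increments in [x] and in [v], decays like
    [|x|^(v - 1/alpha - 2)].  This beats the growth [|k|^(1/alpha + eta)] of [eps j k].
    For [j >= 0] the indices [|k| <= 2 M 2^j] are governed by the sharper bound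
    [C 2^(j/alpha)], while for all others the decay of [Psi] takes over; hence scale [j]
    contributes at most [2^(-j (v - 1/alpha)) min (1, 2^j |u1 - u2|)] to the increment in [u],
    a two-sided geometric sequence centred at [2^j = 1/|u1 - u2|], whose sum is
    [O(|u1 - u2|^(v - 1/alpha))].  All bounds are uniform over the partial sums. *)

(** * Powers and polynomially decaying sums over Z *)

(** The increment in [v] is the delicate one: differentiating [2^(-j v)] or a truncated power in its
    exponent produces a logarithm, unbounded in [j] and in the argument. A small slack [d] absorbs
    it: [|ln t|] is at most a multiple of [t^d + t^(-d)], so every exponent range is widened by [d]
    on both sides and the resulting bounds are linear in [|v1 - v2|]. The decay exponent of the
    transforms becomes [p = 2 - (b - 1/alpha) - d], and summing over [k] against coefficients of
    growth [1/alpha + d] needs [p > 1 + 1/alpha + d], that is [1 - b > 2 d]: this is where [b < 1]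
    enters. At coarse scales the subtracted term [Psi(-k, v)] supplies the factor [2^j |u|] that
    offsets [2^(-j v)]. The maximum of [v1] and [v2] in the exponent comes from passing through a
    corner of the rectangle: [u] moves while [v] is held at the larger value, then [v] moves
    alone. *)

Lemma exp_monotone (x y : R) : x <= y -> exp x <= exp y.
Proof.
  intros [H|H]; [left; now apply exp_increasing|subst; lra].
Qed.

Lemma Rpower_pos (x y : R) : 0 < Rpower x y.
Proof. apply exp_pos. Qed.

Lemma Rpower_le_nonpos (x y e : R) :
  0 < x -> x <= y -> e <= 0 -> Rpower y e <= Rpower x e.
Proof.
  intros Hx Hxy He. unfold Rpower. apply exp_monotone.
  assert (ln x <= ln y) by (apply ln_le; lra). nra.
Qed.

Lemma Rpower_le_1 (x e : R) : 1 <= x -> e <= 0 -> Rpower x e <= 1.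
Proof.
  intros Hx He. apply Rle_trans with (Rpower 1 e).
  - apply Rpower_le_nonpos; lra.
  - unfold Rpower. rewrite ln_1, Rmult_0_r, exp_0. lra.
Qed.

Lemma ln_le_tangent (th z : R) : 0 < th -> 0 < z -> ln z <= th * z - 1 - ln th.
Proof.
  intros Hth Hz.
  assert (H := exp_ineq1_le (ln (th * z))).
  rewrite exp_ln in H by nra. rewrite ln_mult in H by lra. lra.
Qed.

Lemma Rpower_le_pow2 (c d : R) : 0 < c -> 0 < d ->
  exists K, 0 < K /\ forall x, 0 <= x -> Rpower (3 + x) c <= K * pow2 (d * x).
Proof.
  intros Hc Hd.
  assert (Hl := ln_lt_2).
  (* This slope gives [c * th = d * ln 2], so the linear terms of the two exponents agree and only a
     constant is left. *)
  set (th := d * ln 2 / c).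
  assert (Hth : 0 < th) by (unfold th; apply Rdiv_lt_0_compat; nra).
  exists (exp (c * (3 * th - 1 - ln th))). split; [apply exp_pos|].
  intros x Hx. unfold pow2, Rpower. rewrite <- exp_plus. apply exp_monotone.
  assert (H := ln_le_tangent th (3 + x) Hth ltac:(lra)).
  apply Rmult_le_compat_l with (r := c) in H; [|lra].
  replace (d * x * ln 2) with (c * (th * x)) by (unfold th; field; lra).
  lra.
Qed.

Lemma Rpower_between (t lo e hi : R) : lo <= e <= hi ->
  Rpower t e <= Rpower t lo + Rpower t hi.
Proof.
  intros He. assert (H1 := Rpower_pos t lo). assert (H2 := Rpower_pos t hi).
  destruct (Rle_dec 0 (ln t)).
  - assert (Rpower t e <= Rpower t hi) by (apply exp_monotone; nra). lra.
  - assert (Rpower t e <= Rpower t lo) by (apply exp_monotone; nra). lra.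
Qed.

(** Apply [1 + z <= exp z] at [z = d ln t] and [z = - d ln t]. Both powers are kept, so no case
    split on [t < 1] is needed. *)
Lemma abs_ln_le (t d : R) : 0 < d ->
  Rabs (ln t) <= (Rpower t d + Rpower t (- d)) / d.
Proof.
  intros Hd. apply Rmult_le_reg_r with d; [lra|].
  unfold Rdiv. rewrite Rmult_assoc, Rinv_l, Rmult_1_r by lra.
  unfold Rpower.
  assert (H1 := exp_ineq1_le (d * ln t)). assert (H2 := exp_ineq1_le (- d * ln t)).
  assert (H3 := exp_pos (d * ln t)). assert (H4 := exp_pos (- d * ln t)).
  unfold Rabs; destruct (Rcase_abs (ln t)); lra.
Qed.

Lemma exp_diff_le (x y : R) :
  Rabs (exp x - exp y) <= Rabs (x - y) * (exp x + exp y).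
Proof.
  assert (Hx := exp_pos x). assert (Hy := exp_pos y).
  assert (H1 : exp x - exp y <= exp x * (x - y)).
  { assert (H := exp_ineq1_le (y - x)).
    replace (exp y) with (exp x * exp (y - x)) by (rewrite <- exp_plus; f_equal; ring).
    nra. }
  assert (H2 : exp y - exp x <= exp y * (y - x)).
  { assert (H := exp_ineq1_le (x - y)).
    replace (exp x) with (exp y * exp (x - y)) by (rewrite <- exp_plus; f_equal; ring).
    nra. }
  apply Rabs_le. unfold Rabs; destruct (Rcase_abs (x - y)); nra.
Qed.

(** The logarithm from the derivative in the exponent is paid for by widening [[lo, hi]] by [d]. The
    4 counts the products of [t^d], [t^(-d)] with [t^e1], [t^e2], whose exponents all lie in the
    widened range. *)
Lemma Rpower_diff_le (t d lo hi e1 e2 : R) :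
  0 < d -> lo <= e1 <= hi -> lo <= e2 <= hi ->
  Rabs (Rpower t e1 - Rpower t e2) <=
    4 / d * Rabs (e1 - e2) * (Rpower t (lo - d) + Rpower t (hi + d)).
Proof.
  intros Hd H1 H2.
  set (S := Rpower t (lo - d) + Rpower t (hi + d)).
  eapply Rle_trans; [apply exp_diff_le|].
  replace (e1 * ln t - e2 * ln t) with ((e1 - e2) * ln t) by ring.
  rewrite Rabs_mult.
  fold (Rpower t e1). fold (Rpower t e2).
  assert (HS : forall e, lo - d <= e <= hi + d -> Rpower t e <= S)
    by (intros; now apply Rpower_between).
  assert (Hp : (Rpower t d + Rpower t (- d)) * (Rpower t e1 + Rpower t e2) <= 4 * S).
  { rewrite Rmult_plus_distr_l, !Rmult_plus_distr_r, <- !Rpower_plus.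
    assert (Q1 := HS (d + e1) ltac:(lra)). assert (Q2 := HS (d + e2) ltac:(lra)).
    assert (Q4 := HS (- d + e2) ltac:(lra)). assert (Q3 := HS (- d + e1) ltac:(lra)).
    lra. }
  assert (Hl := abs_ln_le t d Hd).
  assert (P1 := Rpower_pos t e1). assert (P2 := Rpower_pos t e2).
  apply Rle_trans with
    (Rabs (e1 - e2) * ((Rpower t d + Rpower t (- d)) / d * (Rpower t e1 + Rpower t e2))).
  - rewrite Rmult_assoc. apply Rmult_le_compat_l; [apply Rabs_pos|].
    apply Rmult_le_compat_r; lra.
  - replace (4 / d * Rabs (e1 - e2) * S) with (Rabs (e1 - e2) * (4 * S / d))
      by (field; lra).
    apply Rmult_le_compat_l; [apply Rabs_pos|].
    replace ((Rpower t d + Rpower t (- d)) / d * (Rpower t e1 + Rpower t e2))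
      with ((Rpower t d + Rpower t (- d)) * (Rpower t e1 + Rpower t e2) / d)
      by (field; lra).
    apply Rmult_le_compat_r; [left; apply Rinv_0_lt_compat; lra|exact Hp].
Qed.

Definition decay (q x : R) : R := Rpower (1 + Rabs x) (- q).

Lemma decay_pos (q x : R) : 0 < decay q x.
Proof. apply Rpower_pos. Qed.

Lemma decay_le_scaled (q c x y : R) : 0 <= q -> 0 < c ->
  1 + Rabs y <= c * (1 + Rabs x) -> decay q x <= Rpower c q * decay q y.
Proof.
  intros Hq Hc H. unfold decay.
  assert (Hx := Rabs_pos x). assert (Hy := Rabs_pos y).
  apply Rle_trans with (Rpower c q * Rpower (c * (1 + Rabs x)) (- q)).
  - rewrite <- Rpower_mult_distr by lra.
    rewrite <- Rmult_assoc, <- Rpower_plus, Rplus_opp_r, Rpower_O, Rmult_1_l by lra.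
    lra.
  - apply Rmult_le_compat_l; [left; apply Rpower_pos|].
    apply Rpower_le_nonpos; lra.
Qed.

Lemma decay_le_1 (q x : R) : 0 <= q -> decay q x <= 1.
Proof.
  intros Hq. unfold decay. assert (H := Rabs_pos x).
  apply Rpower_le_1; lra.
Qed.

(** Weakens geometric decay in the scale index to polynomial decay, so that [sumZ_decay_bound]
    serves the sums over [j] as well as those over [k]. *)
Lemma pow2_le_decay (q d : R) : 0 < q -> 0 < d ->
  exists K, 0 < K /\ forall t, pow2 (- d * Rabs t) <= K * decay q t.
Proof.
  intros Hq Hd.
  destruct (Rpower_le_pow2 q d Hq Hd) as [K [HK H]].
  exists K. split; [exact HK|]. intros t.
  assert (Ht := Rabs_pos t).
  specialize (H (Rabs t) Ht). unfold decay.
  assert (H' : Rpower (1 + Rabs t) q <= Rpower (3 + Rabs t) q)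
    by (apply Rle_Rpower_l; lra).
  replace (- d * Rabs t) with (- (d * Rabs t)) by ring.
  unfold pow2 in *. rewrite !Rpower_Ropp.
  assert (P1 := Rpower_pos 2 (d * Rabs t)).
  assert (P2 := Rpower_pos (1 + Rabs t) q).
  apply Rmult_le_reg_r with (Rpower 2 (d * Rabs t)); [lra|].
  rewrite Rinv_l by lra.
  apply Rmult_le_reg_r with (Rpower (1 + Rabs t) q); [lra|].
  field_simplify; lra.
Qed.

Definition sumZ (N : nat) (f : Z -> R) : R :=
  sum_f_R0 (fun a => f (Z.of_nat a - Z.of_nat N)%Z) (2 * N).

Lemma sumZ_le (N : nat) (f g : Z -> R) :
  (forall k, f k <= g k) -> sumZ N f <= sumZ N g.
Proof. intros H. apply sum_Rle. intros; apply H. Qed.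

Lemma sumZ_scal (N : nat) (c : R) (f : Z -> R) :
  sumZ N (fun k => c * f k) = c * sumZ N f.
Proof.
  unfold sumZ. rewrite scal_sum. apply sum_eq. intros; ring.
Qed.

Lemma sumZ_plus (N : nat) (f g : Z -> R) :
  sumZ N (fun k => f k + g k) = sumZ N f + sumZ N g.
Proof. apply sum_plus. Qed.

Lemma sumZ_minus (N : nat) (f g : Z -> R) :
  sumZ N (fun k => f k - g k) = sumZ N f - sumZ N g.
Proof. apply minus_sum. Qed.

Lemma sumZ_abs (N : nat) (f : Z -> R) :
  Rabs (sumZ N f) <= sumZ N (fun k => Rabs (f k)).
Proof. apply (Rsum_abs (fun a => f (Z.of_nat a - Z.of_nat N)%Z)). Qed.

Lemma sum_telescope (F : R -> R) (x : R) (n : nat) :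
  sum_f_R0 (fun a => F (x - INR a + 1) - F (x - INR a)) n = F (x + 1) - F (x - INR n).
Proof.
  induction n as [|n IH].
  - simpl. rewrite Rminus_0_r. reflexivity.
  - rewrite tech5, IH, S_INR.
    replace (x - (INR n + 1) + 1) with (x - INR n) by ring. ring.
Qed.

(* A bounded primitive of [decay q] up to a constant factor; telescoping it bounds the sum over [k]. *)
Definition decay_prim (q y : R) : R :=
  if Rle_dec 0 y then 1 - Rpower (1 + y) (1 - q) else Rpower (1 - y) (1 - q) - 1.

Lemma Rpower_step (q y : R) : 1 < q -> 0 <= y ->
  (q - 1) * Rpower 2 (- q) * Rpower (1 + y) (- q) <=
  Rpower (1 + y) (1 - q) - Rpower (2 + y) (1 - q).
Proof.
  intros Hq Hy.
  destruct (MVT_cor2 (fun t => Rpower t (1 - q)) (fun t => (1 - q) * Rpower t (1 - q - 1))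
              (1 + y) (2 + y)) as [c [Hc Hr]]; [lra| |].
  { intros c Hc. apply derivable_pt_lim_power. lra. }
  replace (1 - q - 1) with (- q) in Hc by ring.
  replace (2 + y - (1 + y)) with 1 in Hc by ring.
  (* The mean value point satisfies [c <= 2 + y <= 2 (1 + y)], whence the factor [2^(-q)]. *)
  rewrite Rmult_assoc, Rpower_mult_distr by lra.
  assert (Rpower (2 * (1 + y)) (- q) <= Rpower c (- q)) by (apply Rpower_le_nonpos; lra).
  nra.
Qed.

Lemma decay_prim_bound (q y : R) : 1 < q -> -1 <= decay_prim q y <= 1.
Proof.
  intros Hq.
  assert (H1 : forall z, 0 <= z -> Rpower (1 + z) (1 - q) <= 1).
  { intros z Hz. apply Rpower_le_1; lra. }
  unfold decay_prim. destruct (Rle_dec 0 y).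
  - assert (H := Rpower_pos (1 + y) (1 - q)). specialize (H1 y r). lra.
  - assert (H := Rpower_pos (1 - y) (1 - q)). specialize (H1 (- y) ltac:(lra)).
    unfold Rminus in *. lra.
Qed.

Lemma decay_prim_step (q : R) : 1 < q ->
  exists c, 0 < c /\ forall y, c * decay q y <= decay_prim q (y + 1) - decay_prim q y.
Proof.
  intros Hq.
  (* When [[y, y + 1]] contains 0, one endpoint is at distance at least 1/2 from 0; [h] is then a
     lower bound for the increment, and [decay q y <= 1]. *)
  set (h := 1 - Rpower (3 / 2) (1 - q)).
  assert (Hh : 0 < h).
  { unfold h. assert (Rpower (3/2) (1 - q) < Rpower (3/2) 0)
      by (apply Rpower_lt; lra). rewrite Rpower_O in H; lra. }
  set (c0 := (q - 1) * Rpower 2 (- q)).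
  assert (Hc0 : 0 < c0) by (apply Rmult_lt_0_compat; [lra|apply Rpower_pos]).
  exists (Rmin c0 h). split; [now apply Rmin_pos|].
  intros y.
  assert (Hm1 := Rmin_l c0 h). assert (Hm2 := Rmin_r c0 h).
  assert (Hd := decay_pos q y).
  assert (Hd1 := decay_le_1 q y ltac:(lra)).
  assert (H1 : forall z, 0 <= z -> Rpower (1 + z) (1 - q) <= 1).
  { intros z Hz. apply Rpower_le_1; lra. }
  assert (H2 : forall z, 1 / 2 <= z -> Rpower (1 + z) (1 - q) <= Rpower (3 / 2) (1 - q)).
  { intros z Hz. apply Rpower_le_nonpos; lra. }
  unfold decay_prim.
  destruct (Rle_dec 0 (y + 1)); destruct (Rle_dec 0 y); try lra.
  - assert (H := Rpower_step q y Hq r0). fold c0 in H.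
    unfold decay in *. rewrite Rabs_right in * by lra.
    replace (1 + (y + 1)) with (2 + y) by ring. nra.
  - replace (1 - y) with (1 + - y) by ring.
    assert (Rmin c0 h * decay q y <= h) by nra.
    assert (A1 := H1 (y + 1) r). assert (A2 := H1 (- y) ltac:(lra)).
    destruct (Rle_dec (1/2) (- y)).
    + assert (A3 := H2 (- y) r0). unfold h in *. lra.
    + assert (A3 := H2 (y + 1) ltac:(lra)). unfold h in *. lra.
  - assert (H := Rpower_step q (- y - 1) Hq ltac:(lra)). fold c0 in H.
    replace (1 + (- y - 1)) with (- y) in H by ring.
    replace (2 + (- y - 1)) with (1 - y) in H by ring.
    replace (1 - (y + 1)) with (- y) by ring.
    assert (decay q y <= Rpower (- y) (- q)).
    { unfold decay. rewrite Rabs_left by lra. apply Rpower_le_nonpos; lra. }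
    nra.
Qed.

(** The bound is uniform in the real centre [x], which will be [2^j u] in sums over [k] and
    [- log2 |u1 - u2|] in sums over [j]. The 2 in the constant is the oscillation of a primitive
    with values in [[-1, 1]]. *)
Lemma sumZ_decay_bound (q : R) : 1 < q ->
  exists C, 0 < C /\ forall N x, sumZ N (fun k => decay q (x - IZR k)) <= C.
Proof.
  intros Hq. destruct (decay_prim_step q Hq) as [c [Hc H]].
  exists (2 / c). split; [apply Rdiv_lt_0_compat; lra|].
  intros N x.
  apply Rmult_le_reg_l with c; [lra|].
  replace (c * (2 / c)) with 2 by (field; lra).
  rewrite <- sumZ_scal.
  apply Rle_trans with
    (sum_f_R0 (fun a => decay_prim q (x + INR N - INR a + 1) - decay_prim q (x + INR N - INR a)) (2 * N)).
  - apply sum_Rle. intros n _.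
    rewrite minus_IZR, <- !INR_IZR_INZ.
    replace (x - (INR n - INR N)) with (x + INR N - INR n) by ring. apply H.
  - rewrite (sum_telescope (decay_prim q)).
    assert (H1 := decay_prim_bound q (x + INR N + 1) Hq).
    assert (H2 := decay_prim_bound q (x + INR N - INR (2 * N)) Hq). lra.
Qed.

(** * Integrals of continuous functions on the line *)

Lemma continuity_fun_mult (f g : R -> R) :
  continuity f -> continuity g -> continuity (fun x => f x * g x).
Proof. apply continuity_mult. Qed.

Lemma continuity_fun_plus (f g : R -> R) :
  continuity f -> continuity g -> continuity (fun x => f x + g x).
Proof. apply continuity_plus. Qed.

Lemma continuity_fun_minus (f g : R -> R) :
  continuity f -> continuity g -> continuity (fun x => f x - g x).
Proof. apply continuity_minus. Qed.

Lemma continuity_fun_const (c : R) : continuity (fun _ => c).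
Proof. apply continuity_const. intros x y; reflexivity. Qed.

Lemma continuity_fun_id : continuity (fun x => x).
Proof. apply derivable_continuous, derivable_id. Qed.

Lemma continuity_fun_comp (f g : R -> R) :
  continuity f -> continuity g -> continuity (fun x => f (g x)).
Proof. intros Hf Hg. exact (continuity_comp g f Hg Hf). Qed.

Lemma derivable_pt_lim_continuity (f f1 : R -> R) :
  (forall x, derivable_pt_lim f x (f1 x)) -> continuity f.
Proof.
  intros H x. apply derivable_continuous_pt. exists (f1 x). apply H.
Qed.

Ltac cont := repeat first
  [ assumption
  | apply continuity_fun_const
  | apply continuity_fun_id
  | apply continuity_fun_mult
  | apply continuity_fun_minus
  | apply continuity_fun_plus
  | match goal with H : continuity ?f |- continuity (fun x => ?f _) =>
      apply (continuity_fun_comp f); [exact H|] end ].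

Lemma ex_RInt_continuity (f : R -> R) (a b : R) : continuity f -> ex_RInt f a b.
Proof.
  intros Hf. apply (ex_RInt_continuous (V := R_CompleteNormedModule)).
  intros z _. apply continuity_pt_filterlim, Hf.
Qed.

Lemma RInt_lincomb (f g : R -> R) (c d a b : R) : continuity f -> continuity g ->
  RInt (fun t => c * f t + d * g t) a b = c * RInt f a b + d * RInt g a b.
Proof.
  intros Hf Hg.
  apply (is_RInt_unique (V := R_CompleteNormedModule)).
  apply (is_RInt_plus (V := R_NormedModule) (fun t => c * f t) (fun t => d * g t) a b
           (c * RInt f a b) (d * RInt g a b)).
  - apply (is_RInt_scal (V := R_NormedModule) f a b c), (RInt_correct (V := R_CompleteNormedModule)).
    now apply ex_RInt_continuity.
  - apply (is_RInt_scal (V := R_NormedModule) g a b d), (RInt_correct (V := R_CompleteNormedModule)).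
    now apply ex_RInt_continuity.
Qed.

Lemma RInt_const_mult (f : R -> R) (c a b : R) : continuity f ->
  RInt (fun t => c * f t) a b = c * RInt f a b.
Proof.
  intros Hf. apply (is_RInt_unique (V := R_CompleteNormedModule)).
  apply (is_RInt_scal (V := R_NormedModule) f a b c), (RInt_correct (V := R_CompleteNormedModule)).
  now apply ex_RInt_continuity.
Qed.

Lemma RInt_zero (f : R -> R) (a b : R) :
  (forall x, Rmin a b < x < Rmax a b -> f x = 0) -> RInt f a b = 0.
Proof.
  intros H. rewrite (RInt_ext f (fun _ => 0)) by assumption.
  rewrite RInt_const. unfold scal; simpl; unfold mult; simpl. ring.
Qed.

Lemma RInt_support (f : R -> R) (A a b : R) : continuity f -> 0 < A ->
  (forall s, A < Rabs s -> f s = 0) -> a <= - A -> A <= b ->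
  RInt f a b = RInt f (- A) A.
Proof.
  intros Hf HA Hs Ha Hb.
  rewrite <- (RInt_Chasles (V := R_CompleteNormedModule) f a (- A) b)
    by now apply ex_RInt_continuity.
  rewrite <- (RInt_Chasles (V := R_CompleteNormedModule) f (- A) A b)
    by now apply ex_RInt_continuity.
  rewrite (RInt_zero f a (- A)), (RInt_zero f A b).
  - unfold plus; simpl. ring.
  - intros x Hx. rewrite Rmin_left in Hx by lra. apply Hs. rewrite Rabs_right; lra.
  - intros x Hx. rewrite Rmax_right in Hx by lra. apply Hs. rewrite Rabs_left; lra.
Qed.

(** [is_int_R] hides a support radius of its own; both radii are compared with their maximum. *)
Lemma is_int_R_RInt (f : R -> R) (A I : R) : continuity f -> 0 < A ->
  (forall s, A < Rabs s -> f s = 0) -> is_int_R f I -> RInt f (- A) A = I.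
Proof.
  intros Hf HA Hs [A1 [HA1 [Hs1 [pr Hpr]]]].
  rewrite <- RInt_Reals in Hpr. rewrite <- Hpr.
  assert (M1 := Rmax_l A A1). assert (M2 := Rmax_r A A1).
  rewrite <- (RInt_support f A (- Rmax A A1) (Rmax A A1)) by (assumption || lra).
  rewrite <- (RInt_support f A1 (- Rmax A A1) (Rmax A A1)) by (assumption || lra).
  reflexivity.
Qed.

Lemma RInt_bound (f : R -> R) (a b K : R) : continuity f -> a <= b ->
  (forall t, a <= t <= b -> Rabs (f t) <= K) -> Rabs (RInt f a b) <= (b - a) * K.
Proof.
  intros Hf Hab H. apply abs_RInt_le_const; [lra| |assumption].
  now apply ex_RInt_continuity.
Qed.

Lemma RInt_affine (f : R -> R) (u v a b : R) : continuity f ->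
  RInt (fun y => u * f (u * y + v)) a b = RInt f (u * a + v) (u * b + v).
Proof.
  intros Hf. apply (RInt_comp_lin (V := R_CompleteNormedModule)).
  now apply ex_RInt_continuity.
Qed.

Lemma continuity_bounded (f : R -> R) (a b : R) : continuity f ->
  exists K, 0 < K /\ forall x, a <= x <= b -> Rabs (f x) <= K.
Proof.
  intros Hf. destruct (Rle_dec a b) as [Hab|Hab].
  - destruct (continuity_ab_maj (fun x => Rabs (f x)) a b Hab) as [m [Hm _]].
    { intros c _. apply (continuity_fun_comp Rabs f Rcontinuity_abs Hf). }
    exists (Rabs (f m) + 1). split; [assert (H := Rabs_pos (f m)); lra|].
    intros x Hx. specialize (Hm x Hx). simpl in Hm. lra.
  - exists 1. split; [lra|]. intros; lra.
Qed.

(** Two mean value steps, which give the constant [S] instead of [S / 2]. The hypotheses are local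
    to [[lo, hi]] because the lemma is also applied to powers, smooth only away from 0. *)
Lemma taylor_order2 (f f1 f2 : R -> R) (lo hi S x y : R) :
  (forall c, lo <= c <= hi -> derivable_pt_lim f c (f1 c)) ->
  (forall c, lo <= c <= hi -> derivable_pt_lim f1 c (f2 c)) ->
  (forall c, lo <= c <= hi -> Rabs (f2 c) <= S) ->
  lo <= x <= hi -> lo <= y <= hi ->
  Rabs (f y - f x - (y - x) * f1 x) <= S * (y - x) ^ 2.
Proof.
  intros D1 D2 HS Hx Hy.
  assert (Hin : forall u v c, lo <= u <= hi -> lo <= v <= hi ->
            Rmin u v <= c <= Rmax u v -> lo <= c <= hi).
  { intros u v c Hu Hv. unfold Rmin, Rmax. destruct (Rle_dec u v); lra. }
  destruct (MVT_abs (fun t => f t - t * f1 x) (fun t => f1 t - f1 x) x y) as [c [E Hc]].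
  { intros c Hc. apply derivable_pt_lim_minus; [apply D1, (Hin x y); assumption|].
    replace (f1 x) with (1 * f1 x) at 1 by ring.
    replace (1 * f1 x) with (1 * f1 x + c * 0) by ring.
    apply (derivable_pt_lim_mult (fun t => t) (fun _ => f1 x));
      [apply derivable_pt_lim_id|apply derivable_pt_lim_const]. }
  destruct (MVT_abs f1 f2 x c) as [d [E2 Hd]].
  { intros d Hd. apply D2, (Hin x c); try assumption. apply (Hin x y); assumption. }
  replace (f y - f x - (y - x) * f1 x) with (f y - y * f1 x - (f x - x * f1 x)) by ring.
  rewrite E, E2.
  assert (Hcx : Rabs (c - x) <= Rabs (y - x)).
  { revert Hc. unfold Rmin, Rmax, Rabs.
    destruct (Rle_dec x y); destruct (Rcase_abs (c - x)); destruct (Rcase_abs (y - x)); lra. }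
  assert (HSd : Rabs (f2 d) <= S).
  { apply HS, (Hin x c); try assumption. apply (Hin x y); assumption. }
  rewrite <- pow2_abs.
  assert (P1 := Rabs_pos (c - x)). assert (P2 := Rabs_pos (f2 d)).
  assert (Rabs (f2 d) * Rabs (c - x) <= S * Rabs (y - x))
    by (apply Rmult_le_compat; lra).
  nra.
Qed.

(** * Vanishing moments of an orthonormal wavelet *)

Lemma pow2_nat (n : nat) : pow2 (IZR (Z.of_nat n)) = 2 ^ n.
Proof. unfold pow2. rewrite <- INR_IZR_INZ. apply Rpower_pow. lra. Qed.

Lemma wav_0_0 (psi : R -> R) (s : R) : wav psi 0 0 s = psi s.
Proof.
  unfold wav, pow2.
  replace (IZR 0 / 2) with 0 by field.
  rewrite Rpower_O, !Rmult_1_l by lra. f_equal. ring.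
Qed.

(** Substituting [t = 2^n s - k] in the orthogonality of [psi] and its [(n, k)] wavelet turns the
    fine wavelet into [psi] and makes the other factor slowly varying, ready for a Taylor
    expansion. *)
Lemma wavelet_scale_orthogonal (psi : R -> R) (A : R) (n : nat) (k : Z) :
  continuity psi -> 0 < A -> (forall s, A < Rabs s -> psi s = 0) ->
  wavelet_ONB psi -> (0 < n)%nat ->
  RInt (fun t => psi (/ 2 ^ n * (t + IZR k)) * psi t) (- A) A = 0.
Proof.
  intros Hc HA Hs [HO _] Hn.
  set (u := 2 ^ n).
  assert (Hu : 0 < u) by (apply pow_lt; lra).
  assert (Hiu := Rinv_0_lt_compat u Hu).
  specialize (HO 0%Z 0%Z (Z.of_nat n) k).
  replace (Z.eqb 0 (Z.of_nat n)) with false in HO by (symmetry; apply Z.eqb_neq; lia).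
  simpl andb in HO. cbv iota in HO.
  set (F := fun t => psi (/ u * (t + IZR k)) * psi t).
  set (c := pow2 (IZR (Z.of_nat n) / 2)).
  assert (Hcp : 0 < c) by apply Rpower_pos.
  assert (HFc : continuity F) by (unfold F; cont).
  assert (E : forall s, wav psi 0 0 s * wav psi (Z.of_nat n) k s =
                        c * F (u * s + - IZR k)).
  { intros s. rewrite wav_0_0. unfold wav, F. fold c. rewrite pow2_nat. fold u.
    replace (/ u * (u * s + - IZR k + IZR k)) with s by (field; lra).
    unfold Rminus. ring. }
  assert (HFA : continuity (fun s => c * F (u * s + - IZR k))).
  { cont. }
  assert (HI : is_int_R (fun s => c * F (u * s + - IZR k)) 0).
  { destruct HO as [A1 [HA1 [Hz [pr Hpr]]]]. exists A1. split; [exact HA1|].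
    split; [intros s Hs1; rewrite <- E; now apply Hz|].
    assert (ex : ex_RInt (fun s => c * F (u * s + - IZR k)) (- A1) A1)
      by now apply ex_RInt_continuity.
    exists (ex_RInt_Reals_0 _ _ _ ex). rewrite <- RInt_Reals.
    rewrite <- RInt_Reals in Hpr. rewrite <- Hpr. symmetry. apply RInt_ext.
    intros x _. apply E. }
  (* Large enough that [[-B, B]] contains the support of [psi] and its image under [s -> u s - k]
     contains [[-A, A]]. *)
  set (B := A + / u * (A + Rabs (IZR k))).
  assert (Hk := Rabs_pos (IZR k)).
  assert (HB : A <= B) by (unfold B; assert (0 <= / u * (A + Rabs (IZR k))) by (apply Rmult_le_pos; lra); lra).
  assert (HuB : A + Rabs (IZR k) <= u * B).
  { unfold B. rewrite Rmult_plus_distr_l, <- Rmult_assoc, Rinv_r, Rmult_1_l by lra. nra. }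
  apply (is_int_R_RInt _ B) in HI; [|assumption|lra|].
  2:{ intros s Hs1. rewrite <- E, wav_0_0, Hs by lra. ring. }
  fold F.
  assert (Hk2 := Rle_abs (IZR k)). assert (Hk3 := Rle_abs (- IZR k)). rewrite Rabs_Ropp in Hk3.
  rewrite <- (RInt_support F A (u * - B + - IZR k) (u * B + - IZR k)); try assumption; try lra.
  2:{ intros s Hs1. unfold F. rewrite (Hs s Hs1). ring. }
  rewrite <- RInt_affine by assumption.
  assert (HF2 : continuity (fun s => F (u * s + - IZR k))) by cont.
  rewrite RInt_const_mult in HI |- * by assumption.
  assert (RInt (fun s => F (u * s + - IZR k)) (- B) B = 0) by nra.
  rewrite H. exact (Rmult_0_r u).
Qed.

Lemma small_multiple_zero (x C : R) :
  (forall n : nat, (0 < n)%nat -> Rabs x <= C * (/ 2 ^ n)) -> x = 0.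
Proof.
  intros H. destruct (Req_dec x 0) as [|Hx]; [assumption|exfalso].
  assert (Hp := Rabs_pos_lt x Hx).
  assert (HC : 0 < C). { specialize (H 1%nat ltac:(lia)). simpl in H. lra. }
  destruct (pow_lt_1_zero (/ 2)) with (y := Rabs x / C) as [N HN].
  { rewrite Rabs_right; lra. }
  { now apply Rdiv_lt_0_compat. }
  specialize (HN (S N) ltac:(lia)). specialize (H (S N) ltac:(lia)).
  rewrite pow_inv in HN.
  assert (0 < / 2 ^ S N) by (apply Rinv_0_lt_compat, pow_lt; lra).
  rewrite Rabs_right in HN by lra.
  apply Rmult_lt_compat_l with (r := C) in HN; [|lra].
  replace (C * (Rabs x / C)) with (Rabs x) in HN by (field; lra). lra.
Qed.

(* Expand [psi] at [a] in the orthogonality relation between [psi] and a fine-scale wavelet centred within [2^-n] of [a]. *)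
Lemma moment_expansion (psi f1 f2 : R -> R) (A a : R) :
  (forall x, derivable_pt_lim psi x (f1 x)) ->
  (forall x, derivable_pt_lim f1 x (f2 x)) ->
  continuity f2 -> 0 < A -> (forall s, A < Rabs s -> psi s = 0) -> wavelet_ONB psi ->
  exists C, forall n : nat, (0 < n)%nat -> exists th,
    0 <= th <= / 2 ^ n /\
    Rabs ((psi a + th * f1 a) * RInt psi (- A) A
          + / 2 ^ n * f1 a * RInt (fun t => t * psi t) (- A) A) <= C * (/ 2 ^ n) ^ 2.
Proof.
  intros D1 D2 C2 HA Hs HO.
  assert (Hc : continuity psi) by (eapply derivable_pt_lim_continuity; exact D1).
  destruct (continuity_bounded psi (- A) A Hc) as [K [HK HKb]].
  destruct (continuity_bounded f2 (a - (1 + A)) (a + (1 + A)) C2) as [S [HS HSb]].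
  (* Interval length, times the Taylor remainder at displacement at most [(1 + A) 2^-n], times the
     bound on [psi]. *)
  exists (2 * A * (S * (1 + A) ^ 2 * K)). intros n Hn.
  set (w := / 2 ^ n).
  assert (Hu : 0 < 2 ^ n) by (apply pow_lt; lra).
  assert (Hw : 0 < w) by now apply Rinv_0_lt_compat.
  assert (Hw1 : w <= 1).
  { unfold w. rewrite <- Rinv_1. apply Rinv_le_contravar; [lra|]. apply pow_R1_Rle; lra. }
  destruct (archimed (2 ^ n * a)) as [U1 U2].
  (* [up] rounds up, so the centre [k / 2^n] lies to the right of [a] by at most [2^-n]; this offset
     is [th]. *)
  set (k := up (2 ^ n * a)) in *.
  exists (w * IZR k - a).
  assert (Eu : w * 2 ^ n = 1) by (unfold w; field; lra).
  assert (Hth : 0 <= w * IZR k - a <= w).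
  { replace (w * IZR k - a) with (w * (IZR k - 2 ^ n * a))
      by (transitivity (w * IZR k - w * 2 ^ n * a); [ring|rewrite Eu; ring]).
    split; nra. }
  split; [exact Hth|].
  assert (HZ := wavelet_scale_orthogonal psi A n k Hc HA Hs HO Hn). fold w in HZ.
  set (th := w * IZR k - a) in *.
  set (F := fun t => psi (w * (t + IZR k)) * psi t) in HZ.
  (* [G] is [F] with its slow factor replaced by the Taylor polynomial at [a]. As the integral of
     [F] vanishes, that of [G] equals the integral of the remainder. *)
  set (G := fun t => (psi a + th * f1 a) * psi t + w * f1 a * (t * psi t)).
  assert (HF : continuity F) by (unfold F; cont).
  assert (HG : continuity G) by (unfold G; cont).
  rewrite <- RInt_lincomb by cont. fold G.
  assert (L := RInt_lincomb G F 1 (-1) (- A) A HG HF). rewrite HZ in L.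
  assert (EG : RInt G (- A) A = RInt (fun t => 1 * G t + -1 * F t) (- A) A).
  { rewrite L, Rmult_1_l, Rmult_0_r, Rplus_0_r. reflexivity. }
  rewrite EG.
  replace (2 * A * (S * (1 + A) ^ 2 * K) * w ^ 2)
    with ((A - - A) * (S * ((1 + A) * w) ^ 2 * K)) by ring.
  apply RInt_bound; [cont|lra|].
  intros t Ht.
  set (y := th + w * t).
  assert (Hy : Rabs y <= (1 + A) * w) by (apply Rabs_le; unfold y; split; nra).
  assert (Hy2 : Rabs y <= 1 + A) by nra.
  assert (Hy3 := proj1 (Rabs_le_between y (1 + A)) Hy2).
  assert (T := taylor_order2 psi f1 f2 (a - (1 + A)) (a + (1 + A)) S a (a + y)
     (fun c _ => D1 c) (fun c _ => D2 c) HSb ltac:(lra) ltac:(lra)).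
  replace (a + y - a) with y in T by ring.
  replace (1 * G t + -1 * F t) with (- ((psi (a + y) - psi a - y * f1 a) * psi t)).
  2:{ unfold G, F. replace (w * (t + IZR k)) with (a + y) by (unfold y, th; ring).
      unfold y. ring. }
  rewrite Rabs_Ropp, Rabs_mult.
  apply Rmult_le_compat; try apply Rabs_pos; [|now apply HKb].
  eapply Rle_trans; [exact T|]. apply Rmult_le_compat_l; [lra|].
  rewrite <- pow2_abs. assert (H := Rabs_pos y). nra.
Qed.

(** Letting [n] grow in [moment_expansion] gives [psi a * I0 = 0] for every [a], and [psi] is not
    identically zero since its norm is 1; so [I0 = 0]. The next order in [2^-n] then gives
    [f1 a * I1 = 0]. If [I1] were nonzero, [psi] would be constant, hence zero by compact
    support. *)
Lemma wavelet_vanishing_moments (psi f1 f2 : R -> R) (A : R) :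
  (forall x, derivable_pt_lim psi x (f1 x)) ->
  (forall x, derivable_pt_lim f1 x (f2 x)) ->
  continuity f2 -> 0 < A -> (forall s, A < Rabs s -> psi s = 0) -> wavelet_ONB psi ->
  RInt psi (- A) A = 0 /\ RInt (fun t => t * psi t) (- A) A = 0.
Proof.
  intros D1 D2 C2 HA Hs HO.
  assert (Hc : continuity psi) by (eapply derivable_pt_lim_continuity; exact D1).
  assert (Hnz : ~ forall x, psi x = 0).
  { intros H0. destruct HO as [HO _]. specialize (HO 0%Z 0%Z 0%Z 0%Z). simpl in HO.
    assert (E : forall s, wav psi 0 0 s * wav psi 0 0 s = 0)
      by (intros s; unfold wav; rewrite H0; ring).
    destruct HO as [A1 [HA1 [_ [pr Hpr]]]]. rewrite <- RInt_Reals in Hpr.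
    rewrite RInt_zero in Hpr by (intros; apply E). lra. }
  set (I0 := RInt psi (- A) A : R). set (I1 := RInt (fun t => t * psi t) (- A) A : R).
  assert (HI0 : I0 = 0).
  { destruct (Req_dec I0 0) as [|N0]; [assumption|exfalso]. apply Hnz. intros a.
    destruct (moment_expansion psi f1 f2 A a D1 D2 C2 HA Hs HO) as [C HC].
    fold I0 I1 in HC.
    apply Rmult_eq_reg_r with I0; [|assumption]. rewrite Rmult_0_l.
    apply small_multiple_zero with (C + Rabs (f1 a * I0) + Rabs (f1 a * I1)).
    intros n Hn. destruct (HC n Hn) as [th [Hth HE]].
    assert (Hu : 1 <= 2 ^ n) by (apply pow_R1_Rle; lra).
    set (w := / 2 ^ n) in *.
    assert (Hw : 0 < w) by (apply Rinv_0_lt_compat; lra).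
    assert (Hw1 : w <= 1) by (unfold w; rewrite <- Rinv_1; apply Rinv_le_contravar; lra).
    assert (HCp : 0 <= C) by (assert (P := Rle_trans _ _ _ (Rabs_pos _) HE);
      assert (P2 : 0 < w ^ 2) by (apply pow_lt; lra); nra).
    replace (psi a * I0) with (((psi a + th * f1 a) * I0 + w * f1 a * I1)
      - th * (f1 a * I0) - w * (f1 a * I1)) by ring.
    unfold Rminus.
    eapply Rle_trans; [apply Rabs_triang|]. rewrite Rabs_Ropp, Rabs_mult, (Rabs_right w) by lra.
    eapply Rle_trans; [apply Rplus_le_compat_r, Rabs_triang|].
    rewrite Rabs_Ropp, Rabs_mult, (Rabs_right th) by lra.
    assert (P0 := Rabs_pos (f1 a * I0)).
    assert (C * w ^ 2 <= C * w) by (apply Rmult_le_compat_l; nra).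
    assert (th * Rabs (f1 a * I0) <= w * Rabs (f1 a * I0)) by (apply Rmult_le_compat_r; lra).
    lra. }
  split; [exact HI0|].
  destruct (Req_dec I1 0) as [|N1]; [assumption|exfalso]. apply Hnz.
  assert (Hf1 : forall a, f1 a = 0).
  { intros a.
    destruct (moment_expansion psi f1 f2 A a D1 D2 C2 HA Hs HO) as [C HC].
    fold I0 I1 in HC. rewrite HI0 in HC.
    apply Rmult_eq_reg_r with I1; [|assumption]. rewrite Rmult_0_l.
    apply small_multiple_zero with C.
    intros n Hn. destruct (HC n Hn) as [th [Hth HE]].
    assert (Hw : 0 < / 2 ^ n) by (apply Rinv_0_lt_compat, pow_lt; lra).
    set (w := / 2 ^ n) in *.
    rewrite Rmult_0_r, Rplus_0_l, Rmult_assoc, Rabs_mult, (Rabs_right w) in HE by lra.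
    (* With [I0 = 0] the whole left side carries a factor [w] against an error of order [w^2]; one
       [w] cancels. *)
    apply Rmult_le_reg_l with w; [lra|]. lra. }
  intros x.
  destruct (MVT_abs psi f1 x (A + 1)) as [c [E _]]; [intros; apply D1|].
  rewrite Hf1, Rabs_R0, Rmult_0_l in E.
  rewrite (Hs (A + 1)) in E by (rewrite Rabs_right; lra).
  destruct (Req_dec (psi x) 0); [assumption|].
  exfalso. apply (Rabs_no_R0 (0 - psi x)); lra.
Qed.

(** * Decay of kernel transforms of the wavelet *)

(* The last clause is a first-order Taylor expansion of [g] at [x], uniform over
   shifts by at most [B], with a remainder of size [L * decay p x]. *)
Definition admissible_kernel (p B L : R) (g : R -> R) : Prop :=
  continuity g /\ (forall t, t <= 0 -> g t = 0) /\
  (forall t, t <= 3 * B + 1 -> Rabs (g t) <= L) /\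
  exists g1 : R -> R, forall x s, 2 * B + 1 <= x -> Rabs s <= B ->
    Rabs (g (x - s) - g x + s * g1 x) <= L * decay p x.

Definition kernel_transform (A : R) (g phi : R -> R) (x : R) : R :=
  RInt (fun s => g (x - s) * phi s) (- A) A.

Lemma continuity_kernel (g phi : R -> R) (x : R) :
  continuity g -> continuity phi -> continuity (fun s => g (x - s) * phi s).
Proof. intros Hg Hp. cont. Qed.

(** Three regimes. For [x < -B] the kernel only sees negative arguments. For [-B <= x <= 2 B + 1]
    the arguments stay below [3 B + 1] and [decay p x] is bounded below. Beyond, the two moments
    remove the affine part of [g] at [x] and leave the remainder. *)
Lemma kernel_transform_decay (p B : R) : 0 <= p -> 0 < B ->
  exists C, 0 < C /\ forall g L phi K x,
    admissible_kernel p B L g -> continuity phi ->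
    (forall s, Rabs (phi s) <= K) ->
    RInt phi (- B) B = 0 -> RInt (fun t => t * phi t) (- B) B = 0 ->
    Rabs (kernel_transform B g phi x) <= C * L * K * decay p x.
Proof.
  intros Hp HB.
  assert (HR := Rpower_pos (2 * B + 2) p).
  exists (2 * B * (1 + Rpower (2 * B + 2) p)). split; [nra|].
  intros g L phi K x [Cg [Hg0 [Hgb [g1 Hg1]]]] Cphi HK M0 M1.
  assert (HL : 0 <= L) by (eapply Rle_trans; [apply Rabs_pos|apply (Hgb 0); lra]).
  assert (HK0 : 0 <= K) by (eapply Rle_trans; [apply Rabs_pos|apply (HK 0)]).
  assert (HD := decay_pos p x).
  assert (HLK : 0 <= L * K) by nra.
  unfold kernel_transform.
  destruct (Rlt_dec x (- B)) as [H1|H1]; [|destruct (Rle_dec x (2 * B + 1)) as [H2|H2]].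
  - rewrite RInt_zero.
    + rewrite Rabs_R0. repeat apply Rmult_le_pos; lra.
    + intros s Hs. rewrite Rmin_left in Hs by lra. rewrite Hg0; [ring|lra].
  - assert (HD1 : 1 <= Rpower (2 * B + 2) p * decay p x).
    { replace 1 with (decay p 0).
      - apply decay_le_scaled; [lra|lra|]. rewrite Rabs_R0.
        assert (Rabs x <= 2 * B + 1) by (apply Rabs_le; lra). lra.
      - unfold decay, Rpower. rewrite Rabs_R0, Rplus_0_r, ln_1, Rmult_0_r. apply exp_0. }
    eapply Rle_trans; [apply (RInt_bound _ _ _ (L * K)); [now apply continuity_kernel|lra|]|].
    + intros t Ht. rewrite Rabs_mult. apply Rmult_le_compat; try apply Rabs_pos; [apply Hgb; lra|apply HK].
    + replace (2 * B * (1 + Rpower (2 * B + 2) p) * L * K * decay p x)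
        with (2 * B * (L * K) * (decay p x + Rpower (2 * B + 2) p * decay p x)) by ring.
      replace ((B - - B) * (L * K)) with (2 * B * (L * K) * 1) by ring.
      apply Rmult_le_compat_l; [repeat apply Rmult_le_pos; lra|lra].
  - assert (E : RInt (fun s => g (x - s) * phi s) (- B) B =
      RInt (fun s => 1 * (g (x - s) * phi s) + 1 * (- g x * phi s + g1 x * (s * phi s))) (- B) B).
    { rewrite (RInt_lincomb (fun s => g (x - s) * phi s) (fun s => - g x * phi s + g1 x * (s * phi s)));
        [|now apply continuity_kernel|cont].
      rewrite (RInt_lincomb phi (fun s => s * phi s)) by cont.
      rewrite M0, M1, !Rmult_0_r, Rplus_0_r, Rmult_0_r, Rplus_0_r, Rmult_1_l. reflexivity. }
    rewrite E.
    eapply Rle_trans; [apply (RInt_bound _ _ _ (L * decay p x * K)); [cont|lra|]|].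
    + intros t Ht.
      replace (1 * (g (x - t) * phi t) + 1 * (- g x * phi t + g1 x * (t * phi t)))
        with ((g (x - t) - g x + t * g1 x) * phi t) by ring.
      rewrite Rabs_mult. apply Rmult_le_compat; try apply Rabs_pos; [|apply HK].
      apply Hg1; [lra|]. apply Rabs_le; lra.
    + replace (2 * B * (1 + Rpower (2 * B + 2) p) * L * K * decay p x)
        with (2 * B * (L * decay p x * K) * (1 + Rpower (2 * B + 2) p)) by ring.
      replace ((B - - B) * (L * decay p x * K)) with (2 * B * (L * decay p x * K) * 1) by ring.
      apply Rmult_le_compat_l; [|lra].
      repeat apply Rmult_le_pos; lra.
Qed.

Lemma kernel_transform_widen (A B : R) (g phi : R -> R) (x : R) :
  continuity g -> continuity phi -> 0 < A <= B ->
  (forall s, A < Rabs s -> phi s = 0) ->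
  kernel_transform A g phi x = kernel_transform B g phi x.
Proof.
  intros Cg Cp HAB Hs. unfold kernel_transform. symmetry.
  apply RInt_support; try lra; [now apply continuity_kernel|].
  intros s H. rewrite Hs by assumption. ring.
Qed.

Lemma RInt_shift (f : R -> R) (h a b : R) : continuity f ->
  RInt (fun s => f (s + h)) a b = RInt f (a + h) (b + h).
Proof.
  intros Hf. assert (E := RInt_affine f 1 h a b Hf).
  rewrite !Rmult_1_l in E. rewrite <- E. apply RInt_ext.
  intros s _. rewrite Rmult_1_l, Rmult_1_l. reflexivity.
Qed.

(* The increment [psi (. + h) - psi] has two vanishing moments like [psi] and is
   of size [|h|], so the increments of the transform decay like the transform itself. *)
Lemma kernel_transform_increment (p A : R) (psi f1 : R -> R) :
  0 <= p -> 0 < A -> (forall x, derivable_pt_lim psi x (f1 x)) -> continuity f1 ->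
  (forall s, A < Rabs s -> psi s = 0) ->
  RInt psi (- A) A = 0 -> RInt (fun t => t * psi t) (- A) A = 0 ->
  exists C, 0 < C /\ forall g L x y,
    admissible_kernel p (A + 1) L g ->
    Rabs (kernel_transform A g psi x - kernel_transform A g psi y) <=
      C * L * Rmin 1 (Rabs (x - y)) * (decay p x + decay p y).
Proof.
  intros Hp HA D1 C1 Hs M0 M1.
  assert (Cpsi : continuity psi) by (eapply derivable_pt_lim_continuity; exact D1).
  (* Room for the support of [psi (. + h)] when [|h| <= 1]. *)
  set (B := A + 1).
  destruct (kernel_transform_decay p B Hp ltac:(unfold B; lra)) as [C [HC HT]].
  destruct (continuity_bounded psi (- A) A Cpsi) as [K0 [HK0 HK0b]].
  destruct (continuity_bounded f1 (- (A + 2)) (A + 2) C1) as [K1 [HK1 HK1b]].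
  assert (W0 : RInt psi (- B) B = 0).
  { rewrite (RInt_support psi A); try assumption; unfold B; lra. }
  assert (W1 : RInt (fun t => t * psi t) (- B) B = 0).
  { rewrite (RInt_support (fun t => t * psi t) A); try assumption; try (unfold B; lra); [cont|].
    intros s H. rewrite Hs by assumption. ring. }
  exists (C * (K0 + K1)). split; [nra|].
  intros g L x y Hg. assert (Hg' := Hg). destruct Hg' as [Cg [_ [Hgb _]]].
  assert (HL : 0 <= L) by (eapply Rle_trans; [apply Rabs_pos|apply (Hgb 0); unfold B; lra]).
  rewrite !(kernel_transform_widen A B) by (try assumption; unfold B; lra).
  assert (Dx := decay_pos p x). assert (Dy := decay_pos p y).
  assert (HCL : 0 <= C * L) by nra.
  destruct (Rle_dec (Rabs (x - y)) 1) as [H1|H1].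
  - rewrite Rmin_right by lra.
    set (h := x - y) in *.
    assert (Hh : -1 <= h <= 1) by (apply Rabs_le_between; assumption).
    set (phi := fun s => 1 * psi (s + h) + -1 * psi s).
    assert (Cph : continuity (fun s => psi (s + h))) by cont.
    assert (Cphi : continuity phi) by (unfold phi; cont).
    (* A change of variable moves the increment from the kernel, which may be singular at 0, to the
       smooth function [psi]. *)
    assert (E : kernel_transform B g psi x - kernel_transform B g psi y = kernel_transform B g phi y).
    { unfold kernel_transform, phi.
      transitivity (1 * RInt (fun s => g (y - s) * psi (s + h)) (- B) B
                    + -1 * RInt (fun s => g (y - s) * psi s) (- B) B).
      - assert (E1 : RInt (fun s => g (y - s) * psi (s + h)) (- B) B
                  = RInt (fun s => g (x - s) * psi s) (- B) B).
        { transitivity (RInt (fun s => g (x - s) * psi s) (- B + h) (B + h)).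
          { rewrite <- (RInt_shift (fun s => g (x - s) * psi s) h) by (now apply continuity_kernel).
            apply RInt_ext. intros s _. f_equal. f_equal. unfold h. ring. }
          rewrite (RInt_support (fun s => g (x - s) * psi s) A (- B + h)),
                  (RInt_support (fun s => g (x - s) * psi s) A (- B));
            try (unfold B; lra); try (now apply continuity_kernel);
            intros s H; rewrite Hs by assumption; ring. }
        rewrite E1.
        match goal with |- ?a - ?b = _ =>
          generalize (a : R); generalize (b : R); intros; change (r0 - r = 1 * r0 + -1 * r :> R); ring end.
      - rewrite <- RInt_lincomb.
        + apply RInt_ext. intros s _. ring_simplify. reflexivity.
        + apply (continuity_kernel g (fun s => psi (s + h))); assumption.
        + now apply continuity_kernel. }
    rewrite E.
    assert (HB : forall s, Rabs (phi s) <= K1 * Rabs h).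
    { intros s. unfold phi.
      destruct (Rle_dec (Rabs s) (A + 1)) as [Ha|Ha].
      - apply Rabs_le_between in Ha.
        destruct (MVT_abs psi f1 s (s + h)) as [c [Ec Hc]]; [intros; apply D1|].
        replace (1 * psi (s + h) + -1 * psi s) with (psi (s + h) - psi s) by ring.
        rewrite Ec. replace (s + h - s) with h by ring.
        apply Rmult_le_compat_r; [apply Rabs_pos|]. apply HK1b.
        revert Hc. unfold Rmin, Rmax. destruct (Rle_dec s (s + h)); lra.
      - assert (E1 : A < Rabs (s + h)).
        { assert (T := Rabs_triang_inv s (- h)). rewrite Rabs_Ropp in T.
          replace (s - - h) with (s + h) in T by ring. lra. }
        rewrite (Hs (s + h)), (Hs s) by lra. rewrite !Rmult_0_r, Rplus_0_r, Rabs_R0.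
        apply Rmult_le_pos; [lra|apply Rabs_pos]. }
    assert (S0 : RInt (fun s => psi (s + h)) (- B) B = 0).
    { rewrite RInt_shift by assumption.
      rewrite (RInt_support psi A); try assumption; unfold B; lra. }
    assert (N0 : RInt phi (- B) B = 0).
    { unfold phi. rewrite RInt_lincomb by assumption. rewrite S0, W0, !Rmult_0_r, Rplus_0_r. reflexivity. }
    assert (N1 : RInt (fun t => t * phi t) (- B) B = 0).
    { assert (S1 : RInt (fun s => (s + h) * psi (s + h)) (- B) B = 0).
      { rewrite (RInt_shift (fun s => s * psi s)) by cont.
        rewrite (RInt_support (fun s => s * psi s) A); try assumption; try (unfold B; lra); [cont|].
        intros s H. rewrite Hs by assumption. ring. }
      rewrite (RInt_ext _ (fun t => 1 * ((t + h) * psi (t + h)) + 1 * (- h * psi (t + h) + -1 * (t * psi t)))).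
      2:{ intros t _. unfold phi. match goal with |- ?a = ?b => change (a = b :> R) end. ring. }
      rewrite RInt_lincomb by cont. rewrite RInt_lincomb by cont.
      rewrite S1, S0, W1, !Rmult_0_r, !Rplus_0_r, !Rmult_0_r, Rplus_0_r. reflexivity. }
    eapply Rle_trans; [apply (HT g L phi (K1 * Rabs h) y); assumption|].
    replace (C * L * (K1 * Rabs h) * decay p y) with (C * L * Rabs h * (K1 * decay p y)) by ring.
    replace (C * (K0 + K1) * L * Rabs h * (decay p x + decay p y))
      with (C * L * Rabs h * ((K0 + K1) * (decay p x + decay p y))) by ring.
    apply Rmult_le_compat_l; [apply Rmult_le_pos; [lra|apply Rabs_pos]|]. nra.
  - rewrite Rmin_left by lra.
    assert (HKb : forall s, Rabs (psi s) <= K0).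
    { intros s. destruct (Rle_dec (Rabs s) A) as [Ha|Ha].
      - apply HK0b. now apply Rabs_le_between.
      - rewrite Hs by lra. rewrite Rabs_R0. lra. }
    assert (Tx := HT g L psi K0 x Hg Cpsi HKb W0 W1).
    assert (Ty := HT g L psi K0 y Hg Cpsi HKb W0 W1).
    unfold Rminus. eapply Rle_trans; [apply Rabs_triang|]. rewrite Rabs_Ropp.
    replace (C * (K0 + K1) * L * 1 * (decay p x + decay p y))
      with (C * L * K0 * decay p x + C * L * K0 * decay p y + C * L * K1 * (decay p x + decay p y)) by ring.
    assert (0 <= C * L * K1 * (decay p x + decay p y)) by (apply Rmult_le_pos; [nra|lra]).
    lra.
Qed.

(** * Truncated power kernels *)

Lemma pospow_pos_eq (t e : R) : 0 < t -> pospow t e = Rpower t e.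
Proof. intros H. unfold pospow. destruct (Rlt_dec 0 t); [reflexivity|lra]. Qed.

Lemma pospow_nonpos_eq (t e : R) : t <= 0 -> pospow t e = 0.
Proof. intros H. unfold pospow. destruct (Rlt_dec 0 t); [lra|reflexivity]. Qed.

Lemma pospow_nonneg (t e : R) : 0 <= pospow t e.
Proof. unfold pospow. destruct (Rlt_dec 0 t); [left; apply Rpower_pos|lra]. Qed.

Lemma pospow_continuity (e : R) : 0 < e -> continuity (fun t => pospow t e).
Proof.
  intros He x.
  destruct (Rtotal_order x 0) as [Hx|[Hx|Hx]].
  - apply continuity_pt_ext_loc with (fun _ => 0).
    + exists (mkposreal (- x) ltac:(lra)). intros y Hy. simpl in Hy.
      symmetry. apply pospow_nonpos_eq.
      apply Rabs_lt_between' in Hy. lra.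
    + apply continuity_fun_const.
  - subst x. intros eps Heps.
    exists (Rpower eps (/ e)). split; [apply Rpower_pos|].
    intros x [_ Hx]. simpl in *. unfold Rdist in *.
    rewrite (pospow_nonpos_eq 0) by lra. rewrite Rminus_0_r in *.
    rewrite Rabs_right by (apply Rle_ge, pospow_nonneg).
    destruct (Rlt_dec 0 x) as [Hp|Hp].
    + rewrite pospow_pos_eq by assumption. rewrite Rabs_right in Hx by lra.
      replace eps with (Rpower (Rpower eps (/ e)) e).
      * apply Rlt_Rpower_l; lra.
      * rewrite Rpower_mult, Rinv_l, Rpower_1; lra.
    + rewrite pospow_nonpos_eq by lra. assumption.
  - apply continuity_pt_ext_loc with (fun t => Rpower t e).
    + exists (mkposreal x Hx). intros y Hy. simpl in Hy.
      symmetry. apply pospow_pos_eq.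
      apply Rabs_lt_between' in Hy. lra.
    + apply derivable_continuous_pt. eexists. apply derivable_pt_lim_power. assumption.
Qed.

(** For [x >= 2 B + 1] one has [1 + x <= 2 (x - B) <= 2 c], so a power at any point of the Taylor
    interval is controlled by the decay at its centre. *)
Lemma Rpower_le_decay (p B x c : R) : 0 <= p -> 0 < B -> 2 * B + 1 <= x -> x - B <= c ->
  Rpower c (- p) <= Rpower 2 p * decay p x.
Proof.
  intros Hp HB Hx Hc.
  replace (Rpower c (- p)) with (decay p (c - 1)).
  - apply decay_le_scaled; try lra. rewrite !Rabs_right by lra. lra.
  - unfold decay. rewrite Rabs_right by lra. f_equal. ring.
Qed.

Lemma derivable_pt_lim_scaled_power (a e x : R) : 0 < x ->
  derivable_pt_lim (fun t => a * Rpower t e) x (a * e * Rpower x (e - 1)).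
Proof.
  intros Hx. rewrite Rmult_assoc.
  apply (derivable_pt_lim_scal (fun t => Rpower t e)), derivable_pt_lim_power. assumption.
Qed.

(** On the Taylor interval the arguments exceed 1, so the second derivative [k (k - 1) t^(k - 2)] is
    at most [t^(hi - 2)] in size. The exponent gives up a further [d] so that differences of powers
    fit the same class. *)
Lemma pospow_admissible (lo hi d B : R) :
  0 < lo <= hi -> hi + d < 1 -> 0 < d -> 0 < B ->
  exists L, 0 < L /\ forall k, lo <= k <= hi ->
    admissible_kernel (2 - hi - d) B L (fun t => pospow t k).
Proof.
  intros Hlo Hhi Hd HB.
  set (p := 2 - hi - d). set (T := 3 * B + 1).
  assert (HT1 := Rpower_pos T lo). assert (HT2 := Rpower_pos T hi).
  assert (H2p := Rpower_pos 2 p).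
  assert (HB2 : 0 <= B ^ 2) by nra.
  exists (Rpower T lo + Rpower T hi + Rpower 2 p * B ^ 2). split; [nra|].
  intros k Hk. split; [apply pospow_continuity; lra|].
  split; [intros; now apply pospow_nonpos_eq|]. split.
  - intros t Ht. rewrite Rabs_right by (apply Rle_ge, pospow_nonneg).
    destruct (Rlt_dec 0 t) as [Hp|Hp].
    + rewrite pospow_pos_eq by assumption.
      assert (Q := Rpower_between t lo k hi Hk).
      assert (Rpower t lo <= Rpower T lo) by (apply Rle_Rpower_l; unfold T; lra).
      assert (Rpower t hi <= Rpower T hi) by (apply Rle_Rpower_l; unfold T; lra).
      nra.
    + rewrite pospow_nonpos_eq by lra. nra.
  - exists (fun x => k * Rpower x (k - 1)). intros x s Hx Hs.
    apply Rabs_le_between in Hs.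
    rewrite !pospow_pos_eq by lra.
    assert (HD := decay_pos p x).
    assert (Tl := taylor_order2 (fun t => Rpower t k) (fun x => k * Rpower x (k - 1))
       (fun x => k * (k - 1) * Rpower x (k - 1 - 1)) (x - B) (x + B) (Rpower 2 p * decay p x) x (x - s)).
    replace (Rpower (x - s) k - Rpower x k + s * (k * Rpower x (k - 1)))
      with (Rpower (x - s) k - Rpower x k - (x - s - x) * (k * Rpower x (k - 1))) by ring.
    eapply Rle_trans; [apply Tl; try lra|].
    + intros c Hc. apply derivable_pt_lim_power. lra.
    + intros c Hc. apply derivable_pt_lim_scaled_power. lra.
    + intros c Hc. rewrite Rabs_mult, (Rabs_right (Rpower _ _)) by (left; apply Rpower_pos).
      apply Rle_trans with (1 * Rpower c (- p)).
      * apply Rmult_le_compat; [apply Rabs_pos|left; apply Rpower_pos|apply Rabs_le; nra|].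
        apply Rle_Rpower; unfold p; lra.
      * rewrite Rmult_1_l. apply Rpower_le_decay with B; unfold p in *; lra.
    + replace (x - s - x) with (- s) by ring.
      assert ((- s) ^ 2 <= B ^ 2) by nra.
      assert (0 < Rpower 2 p * decay p x) by nra.
      nra.
Qed.

(** Same class, with a constant linear in [|k1 - k2|]. The condition [d < lo] keeps the widened
    exponent [lo - d] positive, so the bound stays finite as [t] tends to 0. *)
Lemma pospow_diff_admissible (lo hi d B : R) :
  0 < lo <= hi -> hi + d < 1 -> 0 < d < lo -> 0 < B ->
  exists L, 0 < L /\ forall k1 k2, lo <= k1 <= hi -> lo <= k2 <= hi ->
    admissible_kernel (2 - hi - d) B (L * Rabs (k1 - k2)) (fun t => pospow t k1 - pospow t k2).
Proof.
  intros Hlo Hhi Hd HB.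
  set (p := 2 - hi - d). set (T := 3 * B + 1).
  assert (HT1 := Rpower_pos T (lo - d)). assert (HT2 := Rpower_pos T (hi + d)).
  assert (H2p := Rpower_pos 2 p).
  assert (HB2 : 0 <= B ^ 2) by nra.
  assert (Hd4 : 0 < 4 / d) by (apply Rdiv_lt_0_compat; lra).
  set (L1 := 4 / d * (Rpower T (lo - d) + Rpower T (hi + d))).
  assert (HL1 : 0 < L1) by (unfold L1; nra).
  set (S0 := (1 + 2 * (4 / d)) * Rpower 2 p).
  assert (HS0 : 0 < S0) by (unfold S0; nra).
  exists (L1 + S0 * B ^ 2). split; [nra|].
  intros k1 k2 Hk1 Hk2.
  assert (HD0 := Rabs_pos (k1 - k2)).
  split; [apply continuity_fun_minus; apply pospow_continuity; lra|].
  split; [intros; rewrite !pospow_nonpos_eq by assumption; ring|]. split.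
  - intros t Ht.
    apply Rle_trans with (L1 * Rabs (k1 - k2)); [|apply Rmult_le_compat_r; nra].
    destruct (Rlt_dec 0 t) as [Hp|Hp].
    + rewrite !pospow_pos_eq by assumption.
      eapply Rle_trans; [apply (Rpower_diff_le t d lo hi); lra|].
      assert (Rpower t (lo - d) <= Rpower T (lo - d)) by (apply Rle_Rpower_l; unfold T; lra).
      assert (Rpower t (hi + d) <= Rpower T (hi + d)) by (apply Rle_Rpower_l; unfold T; lra).
      replace (L1 * Rabs (k1 - k2)) with (4 / d * Rabs (k1 - k2) * (Rpower T (lo - d) + Rpower T (hi + d)))
        by (unfold L1; ring).
      apply Rmult_le_compat_l; [apply Rmult_le_pos|]; lra.
    + rewrite !pospow_nonpos_eq by lra. rewrite Rminus_0_r, Rabs_R0. nra.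
  - exists (fun x => k1 * Rpower x (k1 - 1) - k2 * Rpower x (k2 - 1)). intros x s Hx Hs.
    apply Rabs_le_between in Hs.
    rewrite !pospow_pos_eq by lra.
    assert (HD := decay_pos p x).
    set (S := S0 * Rabs (k1 - k2) * decay p x).
    assert (HS : 0 <= S) by (unfold S; repeat apply Rmult_le_pos; lra).
    assert (Tl := taylor_order2 (fun t => Rpower t k1 - Rpower t k2)
       (fun x => k1 * Rpower x (k1 - 1) - k2 * Rpower x (k2 - 1))
       (fun x => k1 * (k1 - 1) * Rpower x (k1 - 1 - 1) - k2 * (k2 - 1) * Rpower x (k2 - 1 - 1))
       (x - B) (x + B) S x (x - s)).
    set (g1 := k1 * Rpower x (k1 - 1) - k2 * Rpower x (k2 - 1)) in *.
    replace (Rpower (x - s) k1 - Rpower (x - s) k2 - (Rpower x k1 - Rpower x k2) + s * g1)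
      with (Rpower (x - s) k1 - Rpower (x - s) k2 - (Rpower x k1 - Rpower x k2) - (x - s - x) * g1) by ring.
    eapply Rle_trans; [apply Tl; try lra|].
    + intros c Hc. apply (derivable_pt_lim_minus (fun t => Rpower t k1) (fun t => Rpower t k2));
        apply derivable_pt_lim_power; lra.
    + intros c Hc.
      apply (derivable_pt_lim_minus (fun t => k1 * Rpower t (k1 - 1)) (fun t => k2 * Rpower t (k2 - 1)));
        apply derivable_pt_lim_scaled_power; lra.
    + intros c Hc.
      assert (Hdec : Rpower c (- p) <= Rpower 2 p * decay p x)
        by (apply Rpower_le_decay with B; unfold p in *; lra).
      assert (Hc1 : Rpower c (k1 - 1 - 1) <= Rpower c (- p)) by (apply Rle_Rpower; unfold p; lra).
      assert (Hdf := Rpower_diff_le c d (lo - 2) (hi - 2) (k1 - 1 - 1) (k2 - 1 - 1)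
                       ltac:(lra) ltac:(lra) ltac:(lra)).
      replace (k1 - 1 - 1 - (k2 - 1 - 1)) with (k1 - k2) in Hdf by ring.
      assert (Hc2 : Rpower c (lo - 2 - d) <= Rpower c (- p)) by (apply Rle_Rpower; unfold p; lra).
      assert (Hc3 : Rpower c (hi - 2 + d) <= Rpower c (- p)) by (apply Rle_Rpower; unfold p; lra).
      set (Q := Rpower c (- p)) in *.
      assert (HQ : 0 < Q) by apply Rpower_pos.
      (* The coefficient [k (k - 1)] and the power are varied separately; they contribute the 1 and
         the [2 * (4 / d)] of [S0]. *)
      replace (k1 * (k1 - 1) * Rpower c (k1 - 1 - 1) - k2 * (k2 - 1) * Rpower c (k2 - 1 - 1))
        with ((k1 - k2) * ((k1 + k2 - 1) * Rpower c (k1 - 1 - 1))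
              + k2 * (k2 - 1) * (Rpower c (k1 - 1 - 1) - Rpower c (k2 - 1 - 1))) by ring.
      eapply Rle_trans; [apply Rabs_triang|].
      rewrite !Rabs_mult, (Rabs_right (Rpower c (k1 - 1 - 1))) by (left; apply Rpower_pos).
      assert (E1 : Rabs (k1 + k2 - 1) * Rpower c (k1 - 1 - 1) <= 1 * Q)
        by (apply Rmult_le_compat; [apply Rabs_pos|left; apply Rpower_pos|apply Rabs_le; lra|lra]).
      assert (E2 : Rabs k2 * Rabs (k2 - 1) <= 1 * 1)
        by (apply Rmult_le_compat; try apply Rabs_pos; apply Rabs_le; lra).
      assert (E3 : Rabs (Rpower c (k1 - 1 - 1) - Rpower c (k2 - 1 - 1))
                     <= 4 / d * Rabs (k1 - k2) * (2 * Q)).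
      { eapply Rle_trans; [exact Hdf|]. apply Rmult_le_compat_l; [apply Rmult_le_pos|]; lra. }
      assert (E4 : Rabs k2 * Rabs (k2 - 1) * Rabs (Rpower c (k1 - 1 - 1) - Rpower c (k2 - 1 - 1))
                     <= 1 * 1 * (4 / d * Rabs (k1 - k2) * (2 * Q)))
        by (apply Rmult_le_compat; try apply Rabs_pos; [apply Rmult_le_pos; apply Rabs_pos|lra|lra]).
      assert (E5 : Rabs (k1 - k2) * (Rabs (k1 + k2 - 1) * Rpower c (k1 - 1 - 1)) <= Rabs (k1 - k2) * (1 * Q))
        by (apply Rmult_le_compat_l; lra).
      replace S with ((1 + 2 * (4 / d)) * Rabs (k1 - k2) * (Rpower 2 p * decay p x))
        by (unfold S, S0; ring).
      apply Rle_trans with ((1 + 2 * (4 / d)) * Rabs (k1 - k2) * Q); [lra|].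
      apply Rmult_le_compat_l; [apply Rmult_le_pos; lra|lra].
    + replace (x - s - x) with (- s) by ring.
      assert ((- s) ^ 2 <= B ^ 2) by nra.
      apply Rle_trans with (S * B ^ 2); [apply Rmult_le_compat_l; lra|].
      replace ((L1 + S0 * B ^ 2) * Rabs (k1 - k2) * decay p x)
        with (S * B ^ 2 + L1 * Rabs (k1 - k2) * decay p x) by (unfold S; ring).
      assert (0 <= L1 * Rabs (k1 - k2) * decay p x) by (repeat apply Rmult_le_pos; lra).
      lra.
Qed.

(** * Weighted sums over the scales *)

Lemma pow2_pos (t : R) : 0 < pow2 t.
Proof. apply Rpower_pos. Qed.

Lemma pow2_plus (s t : R) : pow2 (s + t) = pow2 s * pow2 t.
Proof. apply Rpower_plus. Qed.

Lemma pow2_le (s t : R) : s <= t -> pow2 s <= pow2 t.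
Proof. intros H. apply Rle_Rpower; lra. Qed.

Lemma pow2_0 : pow2 0 = 1.
Proof. apply Rpower_O. lra. Qed.

Lemma Rpower_pow2 (s t : R) : Rpower (pow2 s) t = pow2 (s * t).
Proof. apply Rpower_mult. Qed.

(** Size, up to a constant, of the decay-weighted sum of [|eps j k|] over [k]. For [j < 0] the slow
    geometric [2^(d |j|)] stands in for a power of [3 + |j|]. *)
Definition scale_weight (alpha d : R) (j : Z) : R :=
  if Z_le_dec 0 j then pow2 (IZR j / alpha) else pow2 (d * Rabs (IZR j)).

Lemma eps_decay_sum_bound (alpha : R) (eps : Z -> Z -> R) (M d p : R) :
  0 < alpha -> 0 < M -> 0 < d -> 1 + (1 / alpha + d) < p ->
  (forall eta, 0 < eta -> exists C, 0 < C /\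
     forall j k : Z, Rabs (eps j k) <=
       C * Rpower (3 + Rabs (IZR j)) (1 / alpha + eta)
         * Rpower (3 + Rabs (IZR k)) (1 / alpha + eta)) ->
  (forall l, 0 < l -> exists C, 0 < C /\
     forall j k : Z, (0 <= j)%Z -> Rabs (IZR k) * pow2 (- IZR j) <= l ->
       Rabs (eps j k) <= C * pow2 (IZR j / alpha)) ->
  exists C, 0 < C /\ forall N j u, Rabs u <= M ->
    sumZ N (fun k => Rabs (eps j k) * decay p (pow2 (IZR j) * u - IZR k)) <=
      C * scale_weight alpha d j.
Proof.
  intros Ha HM Hd Hp HO0 HO1.
  assert (Hia : 0 < 1 / alpha) by (apply Rdiv_lt_0_compat; lra).
  set (e := 1 / alpha + d) in *.
  destruct (HO0 d Hd) as [C0 [HC0 H0]]. fold e in H0. clear HO0.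
  (* With threshold [2 M], an index beyond it satisfies [|2^j u| <= |k| / 2], so its distance to
     [2^j u] is at least [|k| / 2]. *)
  destruct (HO1 (2 * M) ltac:(lra)) as [C1 [HC1 H1]]. clear HO1.
  assert (Hq : 1 < p - e) by lra.
  destruct (sumZ_decay_bound (p - e) Hq) as [Cq [HCq Sq]].
  destruct (sumZ_decay_bound p ltac:(unfold e in *; lra)) as [Cp [HCp Sp]].
  destruct (Rpower_le_pow2 e (1 / alpha) ltac:(unfold e; lra) Hia) as [K1 [HK1 B1]].
  destruct (Rpower_le_pow2 e d ltac:(unfold e; lra) Hd) as [K2 [HK2 B2]].
  assert (P3 := Rpower_pos 3 e). assert (P2 := Rpower_pos 2 p). assert (PM := Rpower_pos (1 + M) p).
  (* Where [|x|] is comparable to [|k|], the growth in [k] uses up [e] of the decay and leaves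
     [p - e > 1], still summable. *)
  assert (Far : forall j k x c, 0 < c -> 1 + Rabs (IZR k) <= c * (1 + Rabs x) ->
     Rabs (eps j k) * decay p x <=
       C0 * Rpower 3 e * Rpower c p * Rpower (3 + Rabs (IZR j)) e * decay (p - e) (0 - IZR k)).
  { intros j k x c Hc Hx.
    assert (Pk := Rabs_pos (IZR k)). assert (Pj := Rabs_pos (IZR j)).
    assert (Pc := Rpower_pos c p). assert (Pje := Rpower_pos (3 + Rabs (IZR j)) e).
    assert (Dx := decay_le_scaled p c x (IZR k) ltac:(unfold e in *; lra) Hc Hx).
    assert (Hk : Rpower (3 + Rabs (IZR k)) e <= Rpower 3 e * Rpower (1 + Rabs (IZR k)) e).
    { rewrite Rpower_mult_distr by lra. apply Rle_Rpower_l; unfold e in *; lra. }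
    assert (Ek : Rpower (1 + Rabs (IZR k)) e * decay p (IZR k) = decay (p - e) (0 - IZR k)).
    { unfold decay. rewrite Rminus_0_l, Rabs_Ropp, <- Rpower_plus. f_equal. ring. }
    eapply Rle_trans; [apply Rmult_le_compat; [apply Rabs_pos|left; apply decay_pos|apply H0|exact Dx]|].
    rewrite <- Ek.
    replace (C0 * Rpower 3 e * Rpower c p * Rpower (3 + Rabs (IZR j)) e *
              (Rpower (1 + Rabs (IZR k)) e * decay p (IZR k)))
      with (C0 * Rpower (3 + Rabs (IZR j)) e * (Rpower 3 e * Rpower (1 + Rabs (IZR k)) e)
             * (Rpower c p * decay p (IZR k))) by ring.
    apply Rmult_le_compat_r; [left; apply Rmult_lt_0_compat; [lra|apply decay_pos]|].
    apply Rmult_le_compat_l; [left; apply Rmult_lt_0_compat; lra|exact Hk]. }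
  set (F1 := C0 * Rpower 3 e * Rpower 2 p * K1).
  set (F2 := C0 * Rpower 3 e * Rpower (1 + M) p * K2).
  assert (HF1 : 0 < F1) by (unfold F1; repeat apply Rmult_lt_0_compat; lra).
  assert (HF2 : 0 < F2) by (unfold F2; repeat apply Rmult_lt_0_compat; lra).
  exists (C1 * Cp + F1 * Cq + F2 * Cq). split; [repeat apply Rplus_lt_0_compat; apply Rmult_lt_0_compat; lra|].
  intros N j u Hu. unfold scale_weight.
  destruct (Z_le_dec 0 j) as [Hj|Hj].
  - assert (Hj' : 0 <= IZR j) by now apply IZR_le.
    set (W := pow2 (IZR j / alpha)). assert (HW : 0 < W) by apply pow2_pos.
    assert (HB : Rpower (3 + Rabs (IZR j)) e <= K1 * W).
    { rewrite Rabs_right by lra. unfold W. replace (IZR j / alpha) with (1 / alpha * IZR j) by (field; lra).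
      now apply B1. }
    apply Rle_trans with (sumZ N (fun k => (C1 * W) * decay p (pow2 (IZR j) * u - IZR k)
                                     + (F1 * W) * decay (p - e) (0 - IZR k))).
    + apply sumZ_le. intros k.
      set (x := pow2 (IZR j) * u - IZR k).
      assert (Dx := decay_pos p x). assert (Dk := decay_pos (p - e) (0 - IZR k)).
      assert (Pos1 : 0 <= C1 * W * decay p x) by (repeat apply Rmult_le_pos; lra).
      assert (Pos2 : 0 <= F1 * W * decay (p - e) (0 - IZR k)) by (repeat apply Rmult_le_pos; lra).
      destruct (Rle_dec (Rabs (IZR k) * pow2 (- IZR j)) (2 * M)) as [Hk|Hk].
      * assert (Rabs (eps j k) * decay p x <= C1 * W * decay p x)
          by (apply Rmult_le_compat_r; [lra|now apply H1]).
        lra.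
      * assert (Hx : 1 + Rabs (IZR k) <= 2 * (1 + Rabs x)).
        { assert (Hs : pow2 (- IZR j) * pow2 (IZR j) = 1).
          { rewrite <- pow2_plus, Rplus_opp_l. apply pow2_0. }
          assert (Q := pow2_pos (IZR j)).
          assert (Hk' : 2 * (pow2 (IZR j) * Rabs u) <= Rabs (IZR k)).
          { apply Rnot_le_lt in Hk. apply Rmult_lt_compat_r with (r := pow2 (IZR j)) in Hk; [|lra].
            rewrite (Rmult_assoc (Rabs (IZR k))), Hs, Rmult_1_r in Hk. nra. }
          assert (T := Rabs_triang_inv (IZR k) (pow2 (IZR j) * u)).
          rewrite Rabs_minus_sym in T. fold x in T.
          rewrite Rabs_mult, (Rabs_right (pow2 (IZR j))) in T by lra. lra. }
        assert (B := Far j k x 2 ltac:(lra) Hx).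
        apply Rle_trans with (F1 * W * decay (p - e) (0 - IZR k)); [|lra].
        eapply Rle_trans; [exact B|]. apply Rmult_le_compat_r; [lra|].
        replace (F1 * W) with (C0 * Rpower 3 e * Rpower 2 p * (K1 * W)) by (unfold F1; ring).
        apply Rmult_le_compat_l; [repeat apply Rmult_le_pos; lra|exact HB].
    + rewrite sumZ_plus, !sumZ_scal.
      assert (A1 := Sp N (pow2 (IZR j) * u)). assert (A2 := Sq N 0).
      assert (C1 * W * sumZ N (fun k => decay p (pow2 (IZR j) * u - IZR k)) <= C1 * W * Cp)
        by (apply Rmult_le_compat_l; [apply Rmult_le_pos; lra|exact A1]).
      assert (F1 * W * sumZ N (fun k => decay (p - e) (0 - IZR k)) <= F1 * W * Cq)
        by (apply Rmult_le_compat_l; [apply Rmult_le_pos; lra|exact A2]).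
      assert (0 <= F2 * Cq * W) by (repeat apply Rmult_le_pos; lra). lra.
  - assert (Hj' : IZR j <= 0) by (apply IZR_le; lia).
    set (W := pow2 (d * Rabs (IZR j))). assert (HW : 0 < W) by apply pow2_pos.
    assert (HB : Rpower (3 + Rabs (IZR j)) e <= K2 * W) by (apply B2, Rabs_pos).
    apply Rle_trans with (sumZ N (fun k => (F2 * W) * decay (p - e) (0 - IZR k))).
    + apply sumZ_le. intros k.
      set (x := pow2 (IZR j) * u - IZR k).
      (* At coarse scales [|2^j u| <= M], so every [k] counts as far. *)
      assert (Hx : 1 + Rabs (IZR k) <= (1 + M) * (1 + Rabs x)).
      { assert (Q := pow2_pos (IZR j)). assert (Q1 := pow2_le _ _ Hj'). rewrite pow2_0 in Q1.
        assert (T := Rabs_triang (pow2 (IZR j) * u) (- x)).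
        replace (pow2 (IZR j) * u + - x) with (IZR k) in T by (unfold x; ring).
        rewrite Rabs_Ropp, Rabs_mult, (Rabs_right (pow2 (IZR j))) in T by lra.
        assert (Px := Rabs_pos x). assert (Pu := Rabs_pos u).
        assert (pow2 (IZR j) * Rabs u <= 1 * M) by (apply Rmult_le_compat; lra).
        nra. }
      assert (B := Far j k x (1 + M) ltac:(lra) Hx).
      eapply Rle_trans; [exact B|]. apply Rmult_le_compat_r; [left; apply decay_pos|].
      replace (F2 * W) with (C0 * Rpower 3 e * Rpower (1 + M) p * (K2 * W)) by (unfold F2; ring).
      apply Rmult_le_compat_l; [repeat apply Rmult_le_pos; lra|exact HB].
    + rewrite sumZ_scal. assert (A2 := Sq N 0).
      assert (F2 * W * sumZ N (fun k => decay (p - e) (0 - IZR k)) <= F2 * W * Cq)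
        by (apply Rmult_le_compat_l; [apply Rmult_le_pos; lra|exact A2]).
      assert (0 <= F1 * Cq * W) by (repeat apply Rmult_le_pos; lra).
      assert (0 <= C1 * Cp * W) by (repeat apply Rmult_le_pos; lra). lra.
Qed.

(** Here [2^y] is [|u1 - u2|]. For [j >= 0] the exponent peaks at [j = -y], falling at rate
    [v - 1/alpha] above and [1 - (v - 1/alpha)] below, both at least [d]. For [j < 0] the rate is
    [1 - v - d >= d], and the total is only linear in [2^y]. *)
Lemma hoelder_scale_bound (alpha d v y : R) (j : Z) :
  0 < d -> d <= v - 1 / alpha -> v + 2 * d <= 1 -> 0 < alpha ->
  pow2 (- IZR j * v) * Rmin 1 (pow2 (IZR j) * pow2 y) * scale_weight alpha d j <=
    pow2 (y * (v - 1 / alpha)) * pow2 (- d * Rabs (- y - IZR j))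
    + pow2 y * pow2 (- d * Rabs (0 - IZR j)).
Proof.
  intros Hd Hv1 Hv2 Ha.
  assert (Hia : 0 < 1 / alpha) by (apply Rdiv_lt_0_compat; lra).
  assert (R1 := Rmin_l 1 (pow2 (IZR j) * pow2 y)). assert (R2 := Rmin_r 1 (pow2 (IZR j) * pow2 y)).
  set (m := Rmin 1 (pow2 (IZR j) * pow2 y)) in *.
  rewrite <- pow2_plus in R2. rewrite <- !pow2_plus.
  assert (Q1 := pow2_pos (y * (v - 1 / alpha) + - d * Rabs (- y - IZR j))).
  assert (Q2 := pow2_pos (y + - d * Rabs (0 - IZR j))).
  assert (G : forall s t w z, m <= pow2 s -> t + s + w <= z ->
             pow2 t * m * pow2 w <= pow2 z).
  { intros s t w z Hs Hz. apply Rle_trans with (pow2 (t + s + w)); [|now apply pow2_le].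
    rewrite !pow2_plus. apply Rmult_le_compat_r; [left; apply pow2_pos|].
    apply Rmult_le_compat_l; [left; apply pow2_pos|assumption]. }
  rewrite <- pow2_0 in R1.
  unfold scale_weight. destruct (Z_le_dec 0 j) as [Hj|Hj].
  - apply IZR_le in Hj.
    replace (IZR j / alpha) with (IZR j * (1 / alpha)) by (field; lra).
    set (ia := 1 / alpha) in *.
    eapply Rle_trans; [|apply Rplus_le_compat_l; left; exact Q2]. rewrite Rplus_0_r.
    destruct (Rle_dec 0 (y + IZR j)).
    + apply (G 0); [exact R1|]. rewrite Rabs_left1 by lra. nra.
    + apply (G (IZR j + y)); [exact R2|]. rewrite Rabs_right by lra. nra.
  - assert (Hj' : IZR j <= 0) by (apply IZR_le; lia).
    eapply Rle_trans; [|apply Rplus_le_compat_r; left; exact Q1]. rewrite Rplus_0_l.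
    apply (G (IZR j + y)); [exact R2|].
    rewrite Rabs_left1 by lra. rewrite Rabs_right by lra. nra.
Qed.

(** The powers with exponents [a - d] and [b + d] dominate [2^(-j v)] together with its logarithm
    for all [v] in [[a, b]]. Fine scales decay at rate [a - d - 1/alpha >= d], coarse ones at rate
    [1 - (b + d) - d >= d]. *)
Lemma lipschitz_scale_bound (alpha d a b M u : R) (j : Z) :
  0 < d -> a <= b -> 2 * d <= a - 1 / alpha -> b + 3 * d <= 1 -> 0 < alpha -> 0 < M ->
  Rabs u <= M ->
  (pow2 (- IZR j * (a - d)) + pow2 (- IZR j * (b + d)))
    * Rmin 1 (pow2 (IZR j) * Rabs u) * scale_weight alpha d j <=
  2 * (1 + M) * pow2 (- d * Rabs (0 - IZR j)).
Proof.
  intros Hd Hab Ha1 Hb1 Ha HM Hu.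
  assert (Hia : 0 < 1 / alpha) by (apply Rdiv_lt_0_compat; lra).
  assert (R1 := Rmin_l 1 (pow2 (IZR j) * Rabs u)). assert (R2 := Rmin_r 1 (pow2 (IZR j) * Rabs u)).
  assert (Q := pow2_pos (- d * Rabs (0 - IZR j))).
  assert (R0 : 0 <= Rmin 1 (pow2 (IZR j) * Rabs u)).
  { apply Rmin_glb; [lra|]. apply Rmult_le_pos; [left; apply pow2_pos|apply Rabs_pos]. }
  set (m := Rmin 1 (pow2 (IZR j) * Rabs u)) in *.
  unfold scale_weight. destruct (Z_le_dec 0 j) as [Hj|Hj].
  - apply IZR_le in Hj.
    replace (IZR j / alpha) with (IZR j * (1 / alpha)) by (field; lra).
    set (ia := 1 / alpha) in *.
    rewrite (Rabs_left1 (0 - IZR j)) in * by lra.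
    assert (E : forall t, t <= IZR j * (- ia - d) ->
              pow2 t * m * pow2 (IZR j * ia) <= 1 * pow2 (- d * - (0 - IZR j))).
    { intros t Ht. apply Rle_trans with (pow2 (t + IZR j * ia)).
      - rewrite pow2_plus. apply Rmult_le_compat_r; [left; apply pow2_pos|].
        assert (P := pow2_pos t). nra.
      - rewrite Rmult_1_l. apply pow2_le. nra. }
    assert (E1 := E (- IZR j * (a - d)) ltac:(nra)). assert (E2 := E (- IZR j * (b + d)) ltac:(nra)).
    nra.
  - assert (Hj' : IZR j <= 0) by (apply IZR_le; lia).
    rewrite (Rabs_left1 (IZR j)) by lra. rewrite (Rabs_right (0 - IZR j)) in * by lra.
    assert (E : forall t, t <= - IZR j * (b + d) ->
              pow2 t * m * pow2 (d * - IZR j) <= M * pow2 (- d * (0 - IZR j))).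
    { intros t Ht. apply Rle_trans with (M * pow2 (t + IZR j + d * - IZR j)).
      - rewrite !pow2_plus.
        assert (P := pow2_pos t). assert (P1 := pow2_pos (IZR j)). assert (P2 := pow2_pos (d * - IZR j)).
        assert (m <= pow2 (IZR j) * M) by nra.
        replace (M * (pow2 t * pow2 (IZR j) * pow2 (d * - IZR j)))
          with (pow2 t * (pow2 (IZR j) * M) * pow2 (d * - IZR j)) by ring.
        apply Rmult_le_compat_r; [lra|]. apply Rmult_le_compat_l; lra.
      - apply Rmult_le_compat_l; [lra|]. apply pow2_le. nra. }
    assert (E1 := E (- IZR j * (a - d)) ltac:(nra)). assert (E2 := E (- IZR j * (b + d)) ltac:(nra)).
    nra.
Qed.

Lemma weighted_sum_bound (alpha d p M C : R) (eps : Z -> Z -> R) :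
  (forall N j u, Rabs u <= M ->
    sumZ N (fun k => Rabs (eps j k) * decay p (pow2 (IZR j) * u - IZR k)) <=
      C * scale_weight alpha d j) ->
  forall N j u1 u2 c (F : Z -> R), Rabs u1 <= M -> Rabs u2 <= M -> 0 <= c ->
    (forall k, Rabs (F k) <= c * Rabs (eps j k) *
       (decay p (pow2 (IZR j) * u1 - IZR k) + decay p (pow2 (IZR j) * u2 - IZR k))) ->
    Rabs (sumZ N F) <= 2 * C * (c * scale_weight alpha d j).
Proof.
  intros H N j u1 u2 c F H1 H2 Hc HF.
  eapply Rle_trans; [apply sumZ_abs|].
  apply Rle_trans with (sumZ N (fun k => c *
     (Rabs (eps j k) * decay p (pow2 (IZR j) * u1 - IZR k)
      + Rabs (eps j k) * decay p (pow2 (IZR j) * u2 - IZR k)))).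
  - apply sumZ_le. intros k. eapply Rle_trans; [apply HF|]. right. ring.
  - rewrite sumZ_scal, sumZ_plus.
    assert (B1 := H N j u1 H1). assert (B2 := H N j u2 H2).
    replace (2 * C * (c * scale_weight alpha d j))
      with (c * (C * scale_weight alpha d j + C * scale_weight alpha d j)) by ring.
    apply Rmult_le_compat_l; lra.
Qed.

(** * Increments of the field [X] *)

Lemma Un_cv_diff_bound (f g : nat -> R) (l1 l2 B : R) :
  Un_cv f l1 -> Un_cv g l2 -> (forall N, Rabs (f N - g N) <= B) -> Rabs (l1 - l2) <= B.
Proof.
  intros Hf Hg HB.
  apply (Rle_cv_lim (Un := fun N => Rabs (f N - g N)) (Vn := fun _ => B)).
  - exact HB.
  - apply (cv_cvabs (fun N => f N - g N)). now apply CV_minus.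
  - intros e He. exists 0%nat. intros. unfold Rdist. rewrite Rminus_diag, Rabs_R0. lra.
Qed.

Lemma sumZ2_sumZ (N : nat) (F : Z -> Z -> R) : sumZ2 N F = sumZ N (fun j => sumZ N (F j)).
Proof. reflexivity. Qed.

Lemma kernel_transform_minus (A : R) (g1 g2 phi : R -> R) (x : R) :
  continuity g1 -> continuity g2 -> continuity phi ->
  kernel_transform A (fun t => g1 t - g2 t) phi x =
    kernel_transform A g1 phi x - kernel_transform A g2 phi x.
Proof.
  intros C1 C2 Cp. unfold kernel_transform.
  transitivity (1 * RInt (fun s => g1 (x - s) * phi s) (- A) A
                + -1 * RInt (fun s => g2 (x - s) * phi s) (- A) A).
  - rewrite <- RInt_lincomb by now apply continuity_kernel.
    apply RInt_ext. intros s _. ring_simplify. reflexivity.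
  - match goal with |- _ = ?a - ?b =>
      generalize (a : R); generalize (b : R); intros; ring end.
Qed.

Theorem mainTheorem3
  (alpha : R) (Halpha : 1 < alpha < 2)
  (psi : R -> R)
  (Hpsi_C3 : C3 psi) (Hpsi_supp : compact_support psi)
  (Hpsi_ONB : wavelet_ONB psi)
  (Psi : R -> R -> R)
  (HPsi : forall x v, 1 / alpha < v < 1 ->
     is_int_R (fun s => pospow (x - s) (v - 1 / alpha) * psi s) (Psi x v))
  (eps : Z -> Z -> R)
  (HOmega0 : forall eta, 0 < eta -> exists C, 0 < C /\
     forall j k : Z, Rabs (eps j k) <=
       C * Rpower (3 + Rabs (IZR j)) (1 / alpha + eta)
         * Rpower (3 + Rabs (IZR k)) (1 / alpha + eta))
  (HOmega1 : forall l, 0 < l -> exists C, 0 < C /\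
     forall j k : Z, (0 <= j)%Z -> Rabs (IZR k) * pow2 (- IZR j) <= l ->
       Rabs (eps j k) <= C * pow2 (IZR j / alpha))
  (X : R -> R -> R)
  (HX : forall u v, 1 / alpha < v < 1 ->
     Un_cv (fun N => sumZ2 N (fun j k =>
        pow2 (- IZR j * v) * eps j k *
        (Psi (pow2 (IZR j) * u - IZR k) v - Psi (- IZR k) v))) (X u v))
  (M a b : R) (HM : 0 < M) (Hab : 1 / alpha < a < b) (Hb : b < 1) :
  exists B : R, forall u1 u2 v1 v2 : R,
    -M <= u1 <= M -> -M <= u2 <= M -> a <= v1 <= b -> a <= v2 <= b ->
    ratio0 (Rabs (X u1 v1 - X u2 v2))
      (pospow (Rabs (u1 - u2)) (Rmax v1 v2 - 1 / alpha) + Rabs (v1 - v2)) <= B.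
Proof.
  assert (Hia : 0 < 1 / alpha) by (apply Rdiv_lt_0_compat; lra).
  destruct Hpsi_C3 as [f1 [f2 [f3 [D1 [D2 [D3 _]]]]]].
  destruct Hpsi_supp as [A [HA Hs]].
  assert (Cpsi := derivable_pt_lim_continuity _ _ D1).
  assert (Cf1 := derivable_pt_lim_continuity _ _ D2).
  assert (Cf2 := derivable_pt_lim_continuity _ _ D3).
  destruct (wavelet_vanishing_moments psi f1 f2 A D1 D2 Cf2 HA Hs Hpsi_ONB) as [M0 M1].
  set (ia := 1 / alpha) in *.
  set (lo := a - ia). set (hi := b - ia).
  (* The first bound yields [p > 1 + 1/alpha + d] and [b + 3 d <= 1]; the second yields
     [2 d <= a - 1/alpha] and [d < lo]. *)
  set (d := Rmin ((1 - b) / 8) (lo / 4)).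
  assert (Hd0 : 0 < d) by (apply Rmin_pos; unfold lo; lra).
  assert (Hd1 : d <= (1 - b) / 8) by apply Rmin_l.
  assert (Hd2 : d <= lo / 4) by apply Rmin_r.
  assert (Hlo : lo = a - ia) by reflexivity. assert (Hhi : hi = b - ia) by reflexivity.
  clearbody d lo hi.
  set (p := 2 - hi - d).
  assert (Hp : 1 + (ia + d) < p) by (unfold p; lra).
  destruct (kernel_transform_increment p A psi f1 ltac:(lra) HA D1 Cf1 Hs M0 M1) as [CT [HCT HT]].
  destruct (pospow_admissible lo hi d (A + 1)) as [L1 [HL1 Adm1]]; try lra.
  destruct (pospow_diff_admissible lo hi d (A + 1)) as [L2 [HL2 Adm2]]; try lra.
  fold p in Adm1, Adm2.
  destruct (eps_decay_sum_bound alpha eps M d p ltac:(lra) HM Hd0 Hp HOmega0 HOmega1) as [CE [HCE HE]].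
  clear HOmega0 HOmega1 M0 M1 Hpsi_ONB.
  assert (EPsi : forall x v, a <= v <= b ->
            Psi x v = kernel_transform A (fun t => pospow t (v - ia)) psi x).
  { intros x v Hv. symmetry. apply is_int_R_RInt; [|lra| |apply HPsi; lra].
    - apply (continuity_kernel (fun t => pospow t (v - ia))); [apply pospow_continuity; lra|assumption].
    - intros s H. rewrite Hs by assumption. ring. }
  assert (P1 : forall x y v, a <= v <= b ->
     Rabs (Psi x v - Psi y v) <= CT * L1 * Rmin 1 (Rabs (x - y)) * (decay p x + decay p y)).
  { intros x y v Hv. rewrite !EPsi by assumption. apply HT, Adm1. lra. }
  assert (P2 : forall x y v w, a <= v <= b -> a <= w <= b ->
     Rabs ((Psi x v - Psi y v) - (Psi x w - Psi y w)) <=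
       CT * (L2 * Rabs (v - w)) * Rmin 1 (Rabs (x - y)) * (decay p x + decay p y)).
  { intros x y v w Hv Hw. rewrite !EPsi by assumption.
    replace (v - w) with (v - ia - (w - ia)) by ring.
    eapply Rle_trans; [|apply HT, Adm2; lra].
    rewrite !kernel_transform_minus by (try assumption; apply pospow_continuity; lra).
    right. f_equal. ring. }
  clear HT EPsi HPsi.
  assert (WS := weighted_sum_bound alpha d p M CE eps HE).
  destruct (sumZ_decay_bound 2 ltac:(lra)) as [CS [HCS HS]].
  destruct (pow2_le_decay 2 d ltac:(lra) Hd0) as [KD [HKD HD]].
  (* The last factor is [1 + (1 + 2 M)]: the peak at [2^j = 1/|u1 - u2|], plus the term linear in
     [|u1 - u2|]. *)
  set (BA := 2 * CE * (CT * L1) * KD * CS * (2 + 2 * M)).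
  assert (HBA : 0 <= BA) by (unfold BA; repeat apply Rmult_le_pos; lra).
  assert (Hu : forall u1 u2 v, -M <= u1 <= M -> -M <= u2 <= M -> a <= v <= b ->
     Rabs (X u1 v - X u2 v) <= BA * pospow (Rabs (u1 - u2)) (v - ia)).
  { intros u1 u2 v Hu1 Hu2 Hv.
    set (h := Rabs (u1 - u2)).
    destruct (Req_dec u1 u2) as [Eu|Nu].
    { subst u2. unfold Rminus at 1. rewrite Rplus_opp_r, Rabs_R0.
      apply Rmult_le_pos; [assumption|apply pospow_nonneg]. }
    assert (Hh : 0 < h) by (apply Rabs_pos_lt; lra).
    assert (Hh2 : h <= 2 * M) by (apply Rabs_le; lra).
    set (y := ln h / ln 2).
    assert (Hl2 := ln_lt_2).
    assert (Hy : pow2 y = h).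
    { unfold pow2, Rpower, y. replace (ln h / ln 2 * ln 2) with (ln h) by (field; lra). now apply exp_ln. }
    rewrite pospow_pos_eq by assumption. rewrite <- Hy, Rpower_pow2.
    set (hk := pow2 (y * (v - ia))). assert (Hhk : 0 < hk) by apply pow2_pos.
    (* The quotient is [h] to an exponent in [[0, 1]], hence at most [1 + h <= 1 + 2 M]. *)
    assert (Hhhk : h <= hk * (1 + 2 * M)).
    { assert (Eh : h = hk * pow2 (y * (1 - (v - ia)))).
      { unfold hk. rewrite <- pow2_plus, <- Hy. f_equal. ring. }
      rewrite Eh at 1. apply Rmult_le_compat_l; [lra|].
      assert (Q := Rpower_between h 0 (1 - (v - ia)) 1 ltac:(lra)).
      rewrite Rpower_O, Rpower_1 in Q by assumption.
      rewrite <- Hy, Rpower_pow2 in Q. rewrite Hy in Q. lra. }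
    eapply Un_cv_diff_bound; [apply HX; lra|apply HX; lra|].
    intros N. cbv beta. rewrite !sumZ2_sumZ, <- sumZ_minus.
    eapply Rle_trans; [apply sumZ_abs|].
    apply Rle_trans with (sumZ N (fun j => 2 * CE * (CT * L1) * KD *
        (hk * decay 2 (- y - IZR j) + h * decay 2 (0 - IZR j)))).
    - apply sumZ_le. intros j. rewrite <- sumZ_minus.
      set (m := Rmin 1 (pow2 (IZR j) * pow2 y)).
      assert (Hm : 0 <= m) by (apply Rmin_glb; [lra|]; apply Rmult_le_pos; left; apply pow2_pos).
      assert (HP := pow2_pos (- IZR j * v)).
      eapply Rle_trans.
      + apply (WS N j u1 u2 (CT * L1 * (pow2 (- IZR j * v) * m)));
          [apply Rabs_le; lra|apply Rabs_le; lra|repeat apply Rmult_le_pos; lra|].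
        intros k.
        set (x1 := pow2 (IZR j) * u1 - IZR k). set (x2 := pow2 (IZR j) * u2 - IZR k).
        replace (pow2 (- IZR j * v) * eps j k * (Psi x1 v - Psi (- IZR k) v)
                 - pow2 (- IZR j * v) * eps j k * (Psi x2 v - Psi (- IZR k) v))
          with (pow2 (- IZR j * v) * eps j k * (Psi x1 v - Psi x2 v)) by ring.
        rewrite !Rabs_mult, (Rabs_right (pow2 _)) by lra.
        assert (Q := P1 x1 x2 v Hv).
        replace (Rabs (x1 - x2)) with (pow2 (IZR j) * pow2 y) in Q.
        2:{ rewrite Hy. unfold h, x1, x2.
            replace (pow2 (IZR j) * u1 - IZR k - (pow2 (IZR j) * u2 - IZR k))
              with (pow2 (IZR j) * (u1 - u2)) by ring.
            rewrite Rabs_mult, (Rabs_right (pow2 _)) by (left; apply pow2_pos). reflexivity. }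
        fold m in Q.
        replace (CT * L1 * (pow2 (- IZR j * v) * m) * Rabs (eps j k) * (decay p x1 + decay p x2))
          with (pow2 (- IZR j * v) * Rabs (eps j k) * (CT * L1 * m * (decay p x1 + decay p x2))) by ring.
        apply Rmult_le_compat_l; [apply Rmult_le_pos; [lra|apply Rabs_pos]|exact Q].
      + assert (Q := hoelder_scale_bound alpha d v y j Hd0 ltac:(fold ia; lra) ltac:(lra) ltac:(lra)).
        fold m ia hk in Q. rewrite Hy in Q.
        assert (Q1 := HD (- y - IZR j)). assert (Q2 := HD (0 - IZR j)).
        replace (2 * CE * (CT * L1 * (pow2 (- IZR j * v) * m) * scale_weight alpha d j))
          with (2 * CE * (CT * L1) * (pow2 (- IZR j * v) * m * scale_weight alpha d j)) by ring.
        rewrite (Rmult_assoc (2 * CE * (CT * L1)) KD).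
        apply Rmult_le_compat_l; [repeat apply Rmult_le_pos; lra|].
        eapply Rle_trans; [exact Q|].
        apply Rmult_le_compat_l with (r := hk) in Q1; [|lra].
        apply Rmult_le_compat_l with (r := h) in Q2; [|lra]. lra.
    - rewrite sumZ_scal, sumZ_plus, !sumZ_scal.
      assert (S1 := HS N (- y)). assert (S2 := HS N 0).
      unfold BA.
      replace (2 * CE * (CT * L1) * KD * CS * (2 + 2 * M) * hk)
        with (2 * CE * (CT * L1) * KD * (hk * CS + hk * (1 + 2 * M) * CS)) by ring.
      apply Rmult_le_compat_l; [repeat apply Rmult_le_pos; lra|].
      apply Rplus_le_compat; [apply Rmult_le_compat_l; lra|].
      apply Rle_trans with (h * CS); [apply Rmult_le_compat_l; lra|].
      apply Rmult_le_compat_r; lra. }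
  assert (Hd4 : 0 < 4 / d) by (apply Rdiv_lt_0_compat; lra).
  (* The first term comes from varying [v] in [2^(-j v)], the second from varying it in [Psi]. *)
  set (K := CT * L1 * (4 / d) + CT * L2).
  assert (HK : 0 < K) by (unfold K; apply Rplus_lt_0_compat; repeat apply Rmult_lt_0_compat; lra).
  set (BB := 2 * CE * K * (2 * (1 + M)) * KD * CS).
  assert (HBB : 0 <= BB) by (unfold BB; repeat apply Rmult_le_pos; lra).
  assert (Hv : forall u v w, -M <= u <= M -> a <= v <= b -> a <= w <= b ->
     Rabs (X u v - X u w) <= BB * Rabs (v - w)).
  { intros u v w Hu0 Hv Hw.
    set (D := Rabs (v - w)). assert (HDp : 0 <= D) by apply Rabs_pos.
    eapply Un_cv_diff_bound; [apply HX; lra|apply HX; lra|].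
    intros N. cbv beta. rewrite !sumZ2_sumZ, <- sumZ_minus.
    eapply Rle_trans; [apply sumZ_abs|].
    apply Rle_trans with (sumZ N (fun j => 2 * CE * K * (2 * (1 + M)) * KD * D * decay 2 (0 - IZR j))).
    - apply sumZ_le. intros j. rewrite <- sumZ_minus.
      set (m := Rmin 1 (pow2 (IZR j) * Rabs u)).
      assert (Hm : 0 <= m)
        by (apply Rmin_glb; [lra|]; apply Rmult_le_pos; [left; apply pow2_pos|apply Rabs_pos]).
      set (T := pow2 (- IZR j * (a - d)) + pow2 (- IZR j * (b + d))).
      assert (HT : 0 < T) by (apply Rplus_lt_0_compat; apply pow2_pos).
      eapply Rle_trans.
      (* The second point is 0 because [- IZR k] is [2^j * 0 - k]; the subtracted [Psi] makes this
         an increment between [u] and 0. *)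
      + apply (WS N j u 0 (K * D * (T * m)));
          [apply Rabs_le; lra|rewrite Rabs_R0; lra|repeat apply Rmult_le_pos; lra|].
        intros k.
        rewrite Rmult_0_r, Rminus_0_l.
        set (x := pow2 (IZR j) * u - IZR k). set (z := - IZR k).
        replace (pow2 (- IZR j * v) * eps j k * (Psi x v - Psi z v)
                 - pow2 (- IZR j * w) * eps j k * (Psi x w - Psi z w))
          with (eps j k * ((pow2 (- IZR j * v) - pow2 (- IZR j * w)) * (Psi x v - Psi z v)
                  + pow2 (- IZR j * w) * ((Psi x v - Psi z v) - (Psi x w - Psi z w)))) by ring.
        assert (Q1 := P1 x z v Hv). assert (Q2 := P2 x z v w Hv Hw).
        assert (Exz : Rabs (x - z) = pow2 (IZR j) * Rabs u).
        { unfold x, z. replace (pow2 (IZR j) * u - IZR k - - IZR k) with (pow2 (IZR j) * u) by ring.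
          rewrite Rabs_mult, (Rabs_right (pow2 _)) by (left; apply pow2_pos). reflexivity. }
        rewrite Exz in Q1, Q2.
        fold m D in Q1, Q2.
        assert (Q3 := Rpower_diff_le (pow2 (- IZR j)) d a b v w Hd0 Hv Hw).
        assert (Q4 := Rpower_between (pow2 (- IZR j)) (a - d) w (b + d) ltac:(lra)).
        rewrite 4!Rpower_pow2 in Q3. rewrite 3!Rpower_pow2 in Q4. fold T D in Q3, Q4.
        set (G := decay p x + decay p z) in *.
        assert (HG : 0 < G) by (apply Rplus_lt_0_compat; apply decay_pos).
        rewrite Rabs_mult.
        replace (K * D * (T * m) * Rabs (eps j k) * G)
          with (Rabs (eps j k) * ((4 / d * D * T) * (CT * L1 * m * G) + T * (CT * (L2 * D) * m * G)))
          by (unfold K; ring).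
        apply Rmult_le_compat_l; [apply Rabs_pos|].
        eapply Rle_trans; [apply Rabs_triang|]. rewrite !Rabs_mult, (Rabs_right (pow2 (- IZR j * w)))
          by (left; apply pow2_pos).
        apply Rplus_le_compat; apply Rmult_le_compat;
          try apply Rabs_pos; try assumption; left; apply pow2_pos.
      + assert (Q := lipschitz_scale_bound alpha d a b M u j Hd0 ltac:(lra) ltac:(fold ia; lra)
                       ltac:(lra) ltac:(lra) HM ltac:(apply Rabs_le; lra)).
        fold m T in Q. assert (Q1 := HD (0 - IZR j)).
        replace (2 * CE * (K * D * (T * m) * scale_weight alpha d j))
          with (2 * CE * K * D * (T * m * scale_weight alpha d j)) by ring.
        replace (2 * CE * K * (2 * (1 + M)) * KD * D * decay 2 (0 - IZR j))
          with (2 * CE * K * D * (2 * (1 + M) * (KD * decay 2 (0 - IZR j)))) by ring.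
        apply Rmult_le_compat_l; [repeat apply Rmult_le_pos; lra|].
        eapply Rle_trans; [exact Q|]. apply Rmult_le_compat_l; lra.
    - rewrite sumZ_scal. assert (S2 := HS N 0). unfold BB.
      replace (2 * CE * K * (2 * (1 + M)) * KD * CS * D)
        with (2 * CE * K * (2 * (1 + M)) * KD * D * CS) by ring.
      apply Rmult_le_compat_l; [repeat apply Rmult_le_pos; lra|exact S2]. }
  exists (BA + BB). intros u1 u2 v1 v2 Hu1 Hu2 Hv1 Hv2.
  set (P := pospow (Rabs (u1 - u2)) (Rmax v1 v2 - ia)).
  assert (HP : 0 <= P) by apply pospow_nonneg.
  assert (HDv := Rabs_pos (v1 - v2)).
  assert (HN : Rabs (X u1 v1 - X u2 v2) <= BA * P + BB * Rabs (v1 - v2)).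
  (* The intermediate point is chosen so that the increment in [u] is taken at the larger of [v1]
     and [v2]. *)
  { unfold P. destruct (Rle_dec v2 v1) as [H|H].
    - rewrite Rmax_left by lra.
      replace (X u1 v1 - X u2 v2) with ((X u1 v1 - X u2 v1) + (X u2 v1 - X u2 v2)) by ring.
      eapply Rle_trans; [apply Rabs_triang|].
      apply Rplus_le_compat; [now apply Hu|now apply Hv].
    - rewrite Rmax_right by lra.
      replace (X u1 v1 - X u2 v2) with ((X u1 v2 - X u2 v2) + (X u1 v1 - X u1 v2)) by ring.
      eapply Rle_trans; [apply Rabs_triang|].
      apply Rplus_le_compat; [now apply Hu|now apply Hv]. }
  unfold ratio0. destruct (Req_EM_T (P + Rabs (v1 - v2)) 0) as [E|E]; [lra|].
  apply Rmult_le_reg_r with (P + Rabs (v1 - v2)); [lra|].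
  unfold Rdiv. rewrite Rmult_assoc, Rinv_l, Rmult_1_r by assumption.
  nra.
Qed.
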